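(* Let $f \in \mathscr{L}^1_*(\mathbb{R})$ and let $F$ be the convolution operator induced by $f$. For a continuous linear functional $\varphi \in L^{\infty}(\mathbb{R})^*$, $\varphi \in \mathscr{M}_F$ if and only if \[\varphi(\phi) \le \overline{P}(\phi)\] holds for every $\phi \in L^{\infty}(\mathbb{R})$.
   Context: All functions are real-valued. $L^{\infty}(\mathbb{R})$ is the space of essentially bounded functions on $\mathbb{R}$ and $L^{\infty}(\mathbb{R})^*$ its dual. For $f \in L^1(\mathbb{R})$, $\hat{f}(\xi) = \int_{-\infty}^{\infty} f(x)e^{-i\xi x}dx$. $\mathscr{L}^1_*(\mathbb{R})$ is the set of $f \in L^1(\mathbb{R})$ such that $\hat{f}(\xi) = 1$ exactly at the point $\xi = 0$ (so $\hat f(0)=1$ and $\hat f(\xi)\neq 1$ for $\xi \neq 0$). The convolution operator induced by $f$ is $F : L^{\infty}(\mathbb{R}) \to L^{\infty}(\mathbb{R})$, $(F\phi)(x) = (f*\phi)(x) = \int_{-\infty}^{\infty}\phi(x-t)f(t)dt$, and $(F^*\varphi)(\phi) = \varphi(F\phi)$. A mean on $L^{\infty}(\mathbb{R})$ is a $\varphi \in L^{\infty}(\mathbb{R})^*$ with $\varphi \ge 0$ and $\|\varphi\| = 1$. $\mathscr{M}_F$ is the set of means $\varphi$ on $L^{\infty}(\mathbb{R})$ with $F^*\varphi = \varphi$ that vanish on every $\phi \in L^{\infty}(\mathbb{R})$ which tends (essentially) to $0$ as $x \to +\infty$. The sublinear functional $\overline{P}$ is \[\overline{P}(\phi) = \lim_{\theta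 \to \infty}\limsup_{x \to \infty}\frac{1}{\theta}\int_x^{x+\theta}\phi(t)dt, \quad \phi \in L^{\infty}(\mathbb{R}).\] *)

(* Defs.v *)
From HB Require Import structures.
From mathcomp Require Import all_boot all_order all_algebra.
From mathcomp Require Import all_classical all_reals all_analysis.
From mathcomp Require Import ess_sup_inf measurable_realfun.
From mathcomp Require Import complex.
Import Order.TTheory GRing.Theory Num.Theory.
Import numFieldNormedType.Exports.

Set Implicit Arguments.
Unset Strict Implicit.
Unset Printing Implicit Defensive.

Local Open Scope classical_set_scope.
Local Open Scope ring_scope.

(* [LspaceType] comes without algebraic structure: the quotient of [LfunType] by
   a.e. equality is made a normed module, operating on representatives. *)
Section Lspace_normed_module.
Context d (T : measurableType d) (R : realType).
Variables (mu : {measure set T -> \bar R}) (p : \bar R) (p1 : (1 <= p)%E).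
Local Notation L := (LspaceType mu p1).
Local Notation LF := (LfunType mu p1).
Local Notation Q := {mfun_ mu, T >-> measurableTypeR R}.

Lemma ae_eq_Lnorm (f g : T -> R) : measurable_fun setT f ->
  measurable_fun setT g -> f = g %[ae mu] ->
  ('N[mu]_p[EFin \o f] = 'N[mu]_p[EFin \o g])%E.
Proof.
move=> mf mg fg; rewrite unlock; case: p p1 => [r r1|_|//].
- pose N (h : T -> R) : T -> \bar R := fun x => (`|(h x)%:E| `^ r)%E.
  have mN h : measurable_fun [set: T] h -> measurable_fun [set: T] (N h).
    move=> mh; rewrite (_ : N h = EFin \o (fun x => (`|h x| `^ r)%R))//.
    apply/measurable_EFinP; apply: (measurableT_comp (measurable_powR r)).
    exact: measurableT_comp.
  congr (_ `^ _)%E; apply: (ae_eq_integral (N g) (N f)) => //; [exact: mN..|].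
  by apply: filterS fg => x fgx _; rewrite /N fgx.
- case: ifPn => // _; apply: eq_ess_sup.
  by apply: filterS fg => x fgx /=; rewrite fgx.
Qed.

Definition Lspace_mfun (f : L) : {mfun T >-> measurableTypeR R} :=
  repr (LebesgueSpace.sort f).

Lemma Lspace_mfun_Lfun (f : L) : (Lspace_mfun f : T -> R) \in Lfun mu p.
Proof.
apply/andP; split; rewrite inE.
  exact: (@measurable_funPT _ _ _ _ (Lspace_mfun f)).
exact: (isFinLebesgue.Lebesgue_finite (LebesgueSpace.class f)).
Qed.

Definition Lspace_rep (f : L) : LF := Lfun_Sub p1 (Lspace_mfun_Lfun f).

(* [R] and [measurableTypeR R] have the same measurable sets but different
   displays; [LspaceType] is built on the latter. *)
Definition Lfun_mfun (u : LF) : {mfun T >-> measurableTypeR R} :=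
  MeasurableFun.Pack (MeasurableFun.Class
    (@isMeasurableFun.Axioms_ _ _ T (measurableTypeR R) u (measurable_funPT u))).

Lemma pi_Lfun_finite (u : LF) : finite_norm mu p ((\pi_Q (Lfun_mfun u))%qT : Q).
Proof.
rewrite /finite_norm (@ae_eq_Lnorm _ u)//; first exact: Lfunction_finite.
- exact: (@measurable_funPT _ _ _ _ (repr (\pi_Q (Lfun_mfun u))%qT)).
- have : (repr (\pi_Q (Lfun_mfun u)) = Lfun_mfun u %[mod Q])%qT by rewrite reprK.
  by move=> /eqquotP/asboolP.
Qed.

Definition Lspace_class (u : LF) : L := LebesgueSpace.Pack
  (LebesgueSpace.Class (isFinLebesgue.Axioms_ T R mu p p1 _ (pi_Lfun_finite u))).

Lemma Lspace_classP (u v : LF) :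
  Lspace_class u = Lspace_class v <-> u = v %[ae mu].
Proof.
split=> [/(congr1 (@LebesgueSpace.sort _ _ _ _ _ _)) /= /eqquotP/asboolP //|uv].
have /eqquotP e : ae_eq_op mu (Lfun_mfun u) (Lfun_mfun v) by exact/asboolP.
rewrite /Lspace_class; move: (pi_Lfun_finite u) (pi_Lfun_finite v).
by rewrite e => h1 h2; rewrite (bool_irrelevance h1 h2).
Qed.

Lemma Lspace_repK : cancel Lspace_rep Lspace_class.
Proof.
case=> q [[h]]; rewrite /Lspace_class; move: (pi_Lfun_finite _).
have -> : Lfun_mfun (Lspace_rep (LebesgueSpace.Pack
    (LebesgueSpace.Class (isFinLebesgue.Axioms_ T R mu p p1 q h)))) = repr q.
  exact: val_inj.
by rewrite reprK => h'; rewrite (bool_irrelevance h h').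
Qed.

Lemma Lspace_classK (u : LF) : Lspace_rep (Lspace_class u) = u %[ae mu].
Proof. by apply/Lspace_classP; rewrite Lspace_repK. Qed.

HB.instance Definition _ := gen_eqMixin L.
HB.instance Definition _ := gen_choiceMixin L.

Let add (f g : L) : L := Lspace_class (Lspace_rep f + Lspace_rep g).
Let opp (f : L) : L := Lspace_class (- Lspace_rep f).
Let scale (a : R) (f : L) : L := Lspace_class (a *: Lspace_rep f).

Let add_class u v : add (Lspace_class u) (Lspace_class v) = Lspace_class (u + v).
Proof.
apply/Lspace_classP; move: (Lspace_classK u) (Lspace_classK v).
by apply: filterS2 => x ux vx _; exact: congr2 (ux I) (vx I).
Qed.

Let opp_class u : opp (Lspace_class u) = Lspace_class (- u).
Proof.
apply/Lspace_classP; move: (Lspace_classK u).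
by apply: filterS => x ux _; exact: congr1 (ux I).
Qed.

Let scale_class a u : scale a (Lspace_class u) = Lspace_class (a *: u).
Proof.
apply/Lspace_classP; move: (Lspace_classK u).
by apply: filterS => x ux _; exact: (congr1 (fun y => a * y) (ux I)).
Qed.

Let addA : associative add.
Proof.
move=> f g h; rewrite -(Lspace_repK f) -(Lspace_repK g) -(Lspace_repK h).
by rewrite !add_class addrA.
Qed.

Let addC : commutative add.
Proof. by move=> f g; rewrite /add addrC. Qed.

Let add0 : left_id (Lspace_class 0) add.
Proof. by move=> f; rewrite -(Lspace_repK f) add_class add0r. Qed.

Let addN : left_inverse (Lspace_class 0) opp add.
Proof. by move=> f; rewrite -(Lspace_repK f) opp_class add_class addNr. Qed.

HB.instance Definition _ := GRing.isZmodule.Build L addA addC add0 addN.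

Let scaleA a b f : scale a (scale b f) = scale (a * b) f.
Proof. by rewrite -(Lspace_repK f) !scale_class scalerA. Qed.

Let scale1 : left_id 1 scale.
Proof. by move=> f; rewrite -(Lspace_repK f) scale_class scale1r. Qed.

Let scaleDr : right_distributive scale +%R.
Proof.
move=> a f g; rewrite -(Lspace_repK f) -(Lspace_repK g).
by rewrite -[_ + _]/(add _ _) -[in RHS]/(add _ _) !(scale_class, add_class) scalerDr.
Qed.

Let scaleDl f : {morph scale^~ f : a b / a + b}.
Proof.
move=> a b /=; rewrite -(Lspace_repK f) -[in RHS]/(add _ _).
by rewrite !(scale_class, add_class) scalerDl.
Qed.

HB.instance Definition _ :=
  GRing.Zmodule_isLmodule.Build R L scaleA scale1 scaleDr scaleDl.

Definition Lspace_norm (f : L) : R := fine ('N[mu]_p[EFin \o Lspace_rep f])%E.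

Lemma Lspace_norm_class u :
  Lspace_norm (Lspace_class u) = fine ('N[mu]_p[EFin \o u])%E.
Proof.
congr fine; apply: ae_eq_Lnorm => //; exact: Lspace_classK.
Qed.

Let ler_Lspace_normD f g : Lspace_norm (f + g) <= Lspace_norm f + Lspace_norm g.
Proof. by rewrite Lspace_norm_class; exact: ler_LnormD. Qed.

Let Lspace_normZ a f : Lspace_norm (a *: f) = `|a| * Lspace_norm f.
Proof.
rewrite Lspace_norm_class -[X in X = _]/(fine _) LnormZ fineM//.
by rewrite -finite_norm_fine.
Qed.

Let Lspace_norm_eq0 f : Lspace_norm f = 0 -> f = 0.
Proof.
move=> /fine_Lnormr_eq0 f0.
by rewrite -(Lspace_repK f); exact/Lspace_classP.
Qed.

HB.instance Definition _ := Lmodule_isNormed.Build R L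
  ler_Lspace_normD Lspace_normZ Lspace_norm_eq0.

End Lspace_normed_module.

Section convolution.
Context {R : realType}.
Local Notation mu := (@lebesgue_measure R).

Definition convolution (f phi : R -> R) : R -> R :=
  fun x => \int[mu]_t (phi (x - t) * f t).

Lemma measurable_subl (x : R) : measurable_fun [set: R] (fun t : R => x - t).
Proof. exact: measurable_funB. Qed.

Lemma lebesgue_measure_subl (x : R) (A : set R) : measurable A ->
  mu ((fun t => x - t) @^-1` A) = mu A.
Proof.
move=> mA.
pose phi : measurableTypeR R -> measurableTypeR R := fun t => x - t.
have mphi : measurable_fun [set: measurableTypeR R] phi by exact: measurable_subl.
pose phim : {mfun measurableTypeR R >-> measurableTypeR R} :=
  MeasurableFun.Pack (MeasurableFun.Class (@isMeasurableFun.Axioms_ _ _ _ _ phi mphi)).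
rewrite -[LHS]/(pushforward mu phim A).
apply/esym/lebesgue_measure_unique => //= _ [[a b]] _ <-.
rewrite /pushforward.
have -> : phim @^-1` [set` `]a, b] ] = [set` `[(x - b), (x - a)[ ].
  apply/seteqP; split => t /=; rewrite !in_itv/= => /andP[? ?]; apply/andP; split.
  - by rewrite lerBlDr -lerBlDl.
  - by rewrite ltrBrDr -ltrBrDl.
  - by rewrite /phim/= /phi ltrBrDr -ltrBrDl.
  - by rewrite /phim/= /phi lerBlDr -lerBlDl.
rewrite /= !lebesgue_measure_itv/= !lte_fin ltrD2l ltrN2.
by case: ifP => // _; rewrite -!EFinB; congr EFin; rewrite opprB [x - a + _]addrC addrA subrK addrC.
Qed.

Lemma ae_subl (x : R) (P : R -> Prop) :
  {ae mu, forall t, P t} -> {ae mu, forall t, P (x - t)}.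
Proof.
move=> [N [mN N0 PN]]; exists ((fun t => x - t) @^-1` N); split.
- by rewrite -[X in measurable X]setTI; exact: (measurable_subl x measurableT).
- by rewrite lebesgue_measure_subl.
- by move=> t nPt; exact: PN.
Qed.

Lemma convolution_ae_eq (f phi psi : R -> R) : measurable_fun setT f ->
  measurable_fun setT phi -> measurable_fun setT psi ->
  phi = psi %[ae mu] -> convolution f phi = convolution f psi.
Proof.
move=> mf mphi mpsi phipsi; apply/funext => x; congr fine.
have mc (g : R -> R) : measurable_fun setT g ->
    measurable_fun setT (fun t : R => (g (x - t) * f t)%:E).
  move=> mg; apply/measurable_EFinP/measurable_funM => //.
  exact: (measurableT_comp mg (measurable_subl x)).
apply: ae_eq_integral => //; [exact: mc..|].
by apply: (@filterS _ _ (ae_filter_ringOfSetsType mu) _ _ _ (ae_subl x phipsi)) => t e _; rewrite e.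
Qed.

Lemma measurable_convolution (f phi : R -> R) :
  measurable_fun setT f -> measurable_fun setT phi ->
  measurable_fun setT (convolution f phi).
Proof.
move=> mf mphi.
pose g (z : R * R) : \bar R := (phi (z.1 - z.2) * f z.2)%:E.
have mg : measurable_fun setT g.
  apply/measurable_EFinP/measurable_funM.
    by apply: (measurableT_comp mphi); exact: measurable_funB.
  exact: (measurableT_comp mf).
have mp := @measurable_fun_fubini_tonelli_F _ _ (measurableTypeR R)
  (measurableTypeR R) R mu (g^\+)%E (measurable_funepos mg) (fun z => funepos_ge0 g z).
have mn := @measurable_fun_fubini_tonelli_F _ _ (measurableTypeR R)
  (measurableTypeR R) R mu (g^\-)%E (measurable_funeneg mg) (fun z => funeneg_ge0 g z).
have mpn := emeasurable_funB mp mn.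
rewrite (_ : convolution f phi =
    fine \o (fubini_F mu g^\+ \- fubini_F mu g^\-)%E).
  exact: (measurableT_comp (fine_measurable measurableT) mpn).
apply/funext => x; rewrite /convolution /Rintegral integralE.
by congr (fine (_ - _)); apply: eq_integral => t _; rewrite ?funeposE ?funenegE.
Qed.

Lemma convolution_Lfun (f phi : R -> R) : f \in Lfun mu 1%E ->
  phi \in Lfun mu +oo%E -> convolution f phi \in Lfun mu +oo%E.
Proof.
move=> fL1 /andP[/set_mem mphi /set_mem phioo].
have /Lfun1_integrable fint := fL1.
have mf : measurable_fun [set: R] f by case/andP: fL1 => /set_mem.
have muT : (0 < mu [set: R])%E.
  by rewrite -set_itvNyy lebesgue_measure_itv/= addye// ltey.
apply/andP; split; apply/mem_set; first exact: measurable_convolution.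
move: phioo; rewrite /= /finite_norm unlock muT => phioo.
have [M M0 phiM] : exists2 M : R, 0 <= M & {ae mu, forall t, `|phi t| <= M}.
  exists (fine (ess_sup mu (abse \o (EFin \o phi)))).
    by rewrite fine_ge0//; apply: ess_sup_gee => //; apply: aeW => t /=; rewrite lee_fin.
  have := ess_sup_ge mu (abse \o (EFin \o phi)).
  have := @ess_sup_gee _ _ _ mu (abse \o (EFin \o phi)) 0 muT (aeW _ (fun=> abse_ge0 _)).
  move: phioo; case: (ess_sup mu _) => [r _ _ h| // |_ /=]; last by rewrite leeNy_eq.
  by apply: (@filterS _ _ (ae_filter_ringOfSetsType mu) _ _ _ h) => t; rewrite lee_fin.
have phifM x : {ae mu, forall t, (`|phi (x - t) * f t| <= M * `|f t|)}.
  apply: (@filterS _ _ (ae_filter_ringOfSetsType mu) _ _ _ (ae_subl x phiM)) => t h.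
  by rewrite normrM ler_wpM2r.
apply: (@le_lt_trans _ _ (M * \int[mu]_t `|f t|)%:E); last by rewrite ltry.
apply/ess_supP/aeW => x /=; rewrite lee_fin.
have mprod : measurable_fun setT (fun t : R => phi (x - t) * f t).
  by apply: measurable_funM => //; exact: (measurableT_comp mphi (measurable_subl x)).
have iMf : mu.-integrable setT (fun t : R => (M * `|f t|)%:E).
  under eq_fun do rewrite EFinM.
  exact: (integrableZl measurableT M (integrable_norm fint)).
have iprod : mu.-integrable setT (fun t : R => (phi (x - t) * f t)%:E).
  have /integrableP[mMf Mfoo] := iMf.
  apply/integrableP; split; first exact/measurable_EFinP.
  apply: le_lt_trans Mfoo; apply: ae_ge0_le_integral => //.
  - exact/measurable_EFinP/measurableT_comp.
  - exact: measurableT_comp.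
  - apply: (@filterS _ _ (ae_filter_ringOfSetsType mu) _ _ _ (phifM x)) => t h _.
    by rewrite lee_fin (le_trans h)// ler_norm.
have -> : M * \int[mu]_t `|f t| = \int[mu]_t (M * `|f t|).
  by rewrite RintegralZl//; exact: integrable_norm.
apply: (le_trans (le_normr_Rintegral _ iprod)) => //.
rewrite -lee_fin /Rintegral !fineK; last 2 first.
- exact: integrable_fin_num.
- exact: (integrable_fin_num _ (integrable_norm iprod)).
apply: ae_ge0_le_integral => //.
- exact/measurable_EFinP/measurableT_comp.
- by move=> t _; rewrite lee_fin mulr_ge0.
- by have /integrableP[] := iMf.
- by apply: (@filterS _ _ (ae_filter_ringOfSetsType mu) _ _ _ (phifM x)) => t h _.
Qed.

End convolution.

Section means.
Context {R : realType}.
Local Notation mu := (@lebesgue_measure R).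

Definition L1 : Type := LspaceType mu (lexx 1%E).
Definition Linfty : Type := LspaceType mu (leey 1%E).
HB.instance Definition _ := NormedModule.on L1.
HB.instance Definition _ := NormedModule.on Linfty.

(* e^{it} *)
Definition expi (t : R) : R[i] := (cos t +i* sin t)%C.

Definition Cintegral (g : R -> R[i]) : R[i] :=
  ((\int[mu]_x complex.Re (g x)) +i* (\int[mu]_x complex.Im (g x)))%C.

Definition fourier (f : L1) (xi : R) : R[i] :=
  Cintegral (fun x => ((f x)%:C)%C * expi (- (xi * x))).

Definition L1_star : set L1 := [set f | forall xi, fourier f xi = 1 <-> xi = 0].

Definition conv_Lfun (f : L1) (u : LfunType mu (leey 1%E)) :
    LfunType mu (leey 1%E) :=
  Lfun_Sub _ (convolution_Lfun (LfunP (Lspace_rep f)) (LfunP u)).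

Definition conv_op (f : L1) (u : Linfty) : Linfty :=
  Lspace_class (conv_Lfun f (Lspace_rep u)).

Lemma conv_op_class (f : L1) (u : LfunType mu (leey 1%E)) :
  conv_op f (Lspace_class u) = Lspace_class (conv_Lfun f u).
Proof.
congr Lspace_class; apply/val_inj => /=.
apply: convolution_ae_eq.
- exact: (@measurable_funPT _ _ _ _ (Lspace_rep f)).
- exact: (@measurable_funPT _ _ _ _ (Lspace_rep (Lspace_class u))).
- exact: (@measurable_funPT _ _ _ _ u).
- exact: Lspace_classK.
Qed.

Definition conv_adjoint (f : L1) (phi : Linfty -> R) : Linfty -> R :=
  phi \o conv_op f.

Definition dual_norm (phi : Linfty -> R) : R :=
  sup [set `|phi u| | u in [set u : Linfty | `|u| <= 1]].

Definition ess_cvg0 (u : Linfty) : Prop :=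
  forall e : R, 0 < e -> exists A : R, {ae mu, forall x, A < x -> `|u x| < e}.

Definition mean : set {linear Linfty -> R^o} :=
  [set phi : {linear Linfty -> R^o} |
  [/\ continuous phi,
      forall u : Linfty, {ae mu, forall x, 0 <= u x} -> 0 <= phi u &
      dual_norm phi = 1]].

Definition invariant_mean (f : L1) : set {linear Linfty -> R^o} :=
  [set phi : {linear Linfty -> R^o} |
  [/\ mean phi,
      conv_adjoint f phi = phi &
      forall u, ess_cvg0 u -> phi u = 0]].

(* The outer limit always exists: the inner limsup is subadditive in theta after
   multiplication by theta. *)
Definition Pbar (u : Linfty) : \bar R :=
  lim (limf_esup
    (fun x : R => (theta^-1 * \int[mu]_(t in `[x, x + theta]) u t)%:E) +oo%R
    @[theta --> +oo%R]).
End means.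
Arguments L1 : clear implicits.
Arguments Linfty : clear implicits.

(* Main.v *)
Require Import Defs.
From HB Require Import structures.
From mathcomp Require Import all_boot all_order all_algebra.
From mathcomp Require Import all_classical all_reals all_analysis.
From mathcomp Require Import ess_sup_inf measurable_realfun.
From mathcomp Require Import complex.
From mathcomp Require Import ring lra.
Import Order.TTheory GRing.Theory Num.Theory.
Import numFieldNormedType.Exports.
Set Implicit Arguments.
Unset Strict Implicit.
Unset Printing Implicit Defensive.
Local Open Scope classical_set_scope.
Local Open Scope ring_scope.

(* A functional below [Pbar] is a mean vanishing on functions that tend to 0, and
   it is invariant because averaging over long windows nearly absorbs a
   convolution with an integrable function of integral 1.

   Conversely let [phi] be an invariant mean.  By positivity it suffices that
   [phi (h * u) = 0] when [h = f - box th] has integral 0, for then [phi u] equals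
   [phi] of any running average of [u].  This is Wiener's theorem for the ideal
   generated by [1 - f], whose only common zero is the origin.  Near a frequency
   [xi <> 0], convolution with [f] is almost multiplication by the Fourier
   coefficient of [f] at [xi], which is not 1, so that [phi] kills every product
   of [e^(i xi x)] with a function of narrow spectrum: iterate
   [phi = c phi + small].  Hence [s |-> phi (fejer s * u)] has vanishing second
   differences along fine grids, and [phi (vallee a * u)] does not depend on [a]
   along multiples.  For [u] replaced by [h * u] it tends to 0 as [a -> 0] and to
   a nonzero multiple of [phi (h * u)] as [a -> oo]. *)

(** * Affine changes of variables *)

(** Spectra of bounded functions are never defined. [vallee_fixed d W] stands for a spectrum inside
    [[-d, d]], and the local inverse of one minus the Fourier transform of [f] in Wiener's argument
    is replaced by an iteration that halves a bound. The obstacle is that the distance of that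
    transform from 1 degenerates at the origin: only frequencies in a compact interval away from 0
    are treated at once, and the grid step is chosen after the interval.

    An identity joins the local statements. In its parameter [s], the Fejer kernel has the second
    differences [2 * (fejer d t * cos (s * t))], pieces with spectrum near [s] and [-s]. Once [phi]
    kills them, [phi] of the Fejer means is affine along the grid, and a Vallee-Poussin mean, being
    a difference quotient of Fejer means, is its slope. Comparing this slope at a low and at a high
    cutoff takes the place of a partition of unity in frequency. *)

Section affine_change_of_variables.
Context {R : realType}.
Local Notation mu := (@lebesgue_measure R).

Lemma measurable_affine (a b : R) : measurable_fun [set: R] (fun t : R => a * t + b).
Proof. by apply: measurable_funD => //; exact: measurable_funM. Qed.

(** Lebesgue measure is determined by half-open intervals, and the scaled pushforward agrees with it
    there. A negative [a] moves the closed end to the other side, which leaves the length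
    unchanged. *)
Lemma lebesgue_measure_affine (a b : R) (A : set R) : a != 0 -> measurable A ->
  (mu A = `|a|%:E * mu ((fun t => (a * t + b)%R) @^-1` A))%E.
Proof.
move=> a0 mA.
pose phi : measurableTypeR R -> measurableTypeR R := fun t => a * t + b.
have mphi : measurable_fun [set: measurableTypeR R] phi by exact: measurable_affine.
pose phim : {mfun measurableTypeR R >-> measurableTypeR R} :=
  MeasurableFun.Pack (MeasurableFun.Class (@isMeasurableFun.Axioms_ _ _ _ _ phi mphi)).
pose nu : {measure set (measurableTypeR R) -> \bar R} :=
  mscale (NngNum (normr_ge0 a)) (pushforward mu phim).
rewrite -[RHS]/(nu mphi A).
apply: lebesgue_measure_unique => //= _ [[x y]] _ <-; rewrite /nu.
rewrite /mscale /= /pushforward.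
case: (ltgtP a 0) a0 => // a0 _.
- have -> : phim @^-1` [set` `]x, y] ] = [set` `[(y - b) / a, (x - b) / a[ ].
    apply/seteqP; split => t /=; rewrite !in_itv/=.
      move=> /andP[? ?]; apply/andP; split.
      + by rewrite ler_ndivrMr// lerBrDr mulrC.
      + by rewrite ltr_ndivlMr// ltrBlDr mulrC.
    move=> /andP[]; rewrite ler_ndivrMr// ltr_ndivlMr// lerBrDr ltrBlDr.
    by rewrite /phim/= /phi [_ * t]mulrC => -> ->.
  rewrite !lebesgue_measure_itv/= !lte_fin ltr_ndivrMr// divfK ?lt_eqF//.
  rewrite ltrD2r; case: ifP; rewrite ?mule0// => _.
  rewrite -!EFinB -EFinM; congr EFin; rewrite (ltr0_norm a0); field.
  by rewrite lt_eqF.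
- have -> : phim @^-1` [set` `]x, y] ] = [set` `](x - b) / a, (y - b) / a] ].
    apply/seteqP; split => t /=; rewrite !in_itv/=.
      move=> /andP[? ?]; apply/andP; split.
      + by rewrite ltr_pdivrMr// ltrBlDr mulrC.
      + by rewrite ler_pdivlMr// lerBrDr mulrC.
    move=> /andP[]; rewrite ltr_pdivrMr// ler_pdivlMr// ltrBlDr lerBrDr.
    by rewrite /phim/= /phi [_ * t]mulrC => -> ->.
  rewrite !lebesgue_measure_itv/= !lte_fin ltr_pdivrMr// divfK ?gt_eqF//.
  rewrite ltrD2r; case: ifP; rewrite ?mule0// => _.
  rewrite -!EFinB -EFinM; congr EFin; rewrite (gtr0_norm a0); field.
  by rewrite gt_eqF.
Qed.

Lemma ge0_integral_affine (a b : R) (F : R -> \bar R) : a != 0 ->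
  measurable_fun setT F -> (forall x, 0 <= F x)%E ->
  (\int[mu]_x F x = `|a|%:E * \int[mu]_x F (a * x + b)%R)%E.
Proof.
move=> a0 mF F0.
pose phi : measurableTypeR R -> measurableTypeR R := fun t => a * t + b.
have mphi : measurable_fun [set: measurableTypeR R] phi by exact: measurable_affine.
pose phim : {mfun measurableTypeR R >-> measurableTypeR R} :=
  MeasurableFun.Pack (MeasurableFun.Class (@isMeasurableFun.Axioms_ _ _ _ _ phi mphi)).
pose nu : {measure set (measurableTypeR R) -> \bar R} :=
  mscale (NngNum (normr_ge0 a)) (pushforward mu phim).
transitivity (\int[nu mphi]_x F x)%E.
  by apply: eq_measure_integral => A mA _; exact: lebesgue_measure_affine.
rewrite ge0_integral_mscale//=; congr (_ * _)%E.
rewrite (@ge0_integral_pushforward _ _ _ _ R phi mphi mu setT F)//.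
Qed.

Lemma measurable_comp_affine (a b : R) (F : R -> R) :
  measurable_fun setT F -> measurable_fun setT (fun x => F (a * x + b)).
Proof. by move=> mF; exact: (measurableT_comp mF (measurable_affine a b)). Qed.

Lemma integrable_affine (a b : R) (F : R -> R) : a != 0 ->
  mu.-integrable setT (EFin \o F) ->
  mu.-integrable setT (EFin \o (fun x => F (a * x + b))).
Proof.
move=> a0 /integrableP[/measurable_EFinP mF Foo]; apply/integrableP; split.
  by apply/measurable_EFinP; exact: (@measurable_comp_affine a b F mF).
move: Foo; rewrite (@ge0_integral_affine a b (fun x => `|(F x)%:E|%E))//.
  by rewrite -lte_pdivlMl ?normr_gt0// mulry gtr0_sg ?invr_gt0 ?normr_gt0// mul1e.
by apply: measurableT_comp => //; apply/measurable_EFinP.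
Qed.

Lemma Rintegral_affine (a b : R) (F : R -> R) : a != 0 ->
  mu.-integrable setT (EFin \o F) ->
  \int[mu]_x F (a * x + b) = `|a|^-1 * \int[mu]_x F x.
Proof.
move=> a0 iF; have iG := integrable_affine b a0 iF.
have /integrableP[/measurable_EFinP mF _] := iF.
have mE : measurable_fun setT (EFin \o F) by exact/measurable_EFinP.
suff -> : \int[mu]_x F x = `|a| * \int[mu]_x F (a * x + b).
  by rewrite mulrA mulVf ?mul1r// normr_eq0.
rewrite /Rintegral -[X in X * _]/(fine `|a|%:E) -fineM//; last exact: integrable_fin_num.
congr fine; rewrite integralE [in RHS]integralE muleBr//; last first.
  apply: fin_num_adde_defl; rewrite fin_numN. by apply: integrable_neg_fin_num.
congr (_ - _)%E.
  rewrite (ge0_integral_affine b a0 (measurable_funepos mE) (funepos_ge0 _)).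
  by congr (_ * _)%E; apply: eq_integral => x _; rewrite !funeposE.
rewrite (ge0_integral_affine b a0 (measurable_funeneg mE) (funeneg_ge0 _)).
by congr (_ * _)%E; apply: eq_integral => x _; rewrite !funenegE.
Qed.

End affine_change_of_variables.

(** * Convolution of integrable and bounded functions *)

Section convolution_theory.
Context {R : realType}.
Local Notation mu := (@lebesgue_measure R).
Local Notation L1fun g := (mu.-integrable setT (EFin \o (g : R -> R))).
Implicit Types (f g h u v K : R -> R).

Lemma L1_measurable g : L1fun g -> measurable_fun setT g.
Proof. by case/integrableP => /measurable_EFinP. Qed.

Lemma L1_norm g : L1fun g -> L1fun (fun x => `|g x|).
Proof. exact: integrable_norm. Qed.

Lemma L1_dominated g h : measurable_fun setT g -> (forall x, `|g x| <= h x) ->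
  L1fun h -> L1fun g.
Proof.
move=> mg gh; apply: le_integrable => //; first exact/measurable_EFinP.
by move=> x _; rewrite /= lee_fin (le_trans (gh x))// ler_norm.
Qed.

Lemma L1D g h : L1fun g -> L1fun h -> L1fun (fun x => g x + h x).
Proof. by move=> ig ih; exact: (integrableD _ ig ih). Qed.

Lemma L1B g h : L1fun g -> L1fun h -> L1fun (fun x => g x - h x).
Proof. by move=> ig ih; exact: (integrableB _ ig ih). Qed.

Lemma L1Z (c : R) g : L1fun g -> L1fun (fun x => c * g x).
Proof. by move=> ig; exact: (integrableZl _ c ig). Qed.

(** The bound holds everywhere, not almost everywhere, so that estimates can be made pointwise;
    [truncation] supplies such a representative of each class in [Linfty]. *)
Definition bounded_by (M : R) u :=
  measurable_fun setT u /\ forall x, `|u x| <= M.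

Lemma bounded_by_ge0 M u : bounded_by M u -> 0 <= M.
Proof. by move=> [_ /(_ 0)]; exact: le_trans. Qed.

Lemma bounded_byD M N u v : bounded_by M u -> bounded_by N v ->
  bounded_by (M + N) (fun x => u x + v x).
Proof.
move=> [mu uM] [mv vN]; split; first exact: measurable_funD.
by move=> x; rewrite (le_trans (ler_normD _ _))// lerD.
Qed.

Lemma bounded_byM M N u v : bounded_by M u -> bounded_by N v ->
  bounded_by (M * N) (fun x => u x * v x).
Proof.
move=> [mu uM] [mv vN]; split; first exact: measurable_funM.
by move=> x; rewrite normrM ler_pM.
Qed.

Lemma bounded_by_cst (c : R) : bounded_by `|c| (cst c).
Proof. by split. Qed.

Lemma bounded_byZ c M u : bounded_by M u -> bounded_by (`|c| * M) (fun x => c * u x).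
Proof. by move=> uM; apply: (bounded_byM (bounded_by_cst c) uM). Qed.

Lemma bounded_byB M N u v : bounded_by M u -> bounded_by N v ->
  bounded_by (M + N) (fun x => u x - v x).
Proof.
move=> [mu uM] [mv vN]; split; first exact: measurable_funB.
by move=> x; rewrite (le_trans (ler_normB _ _))// lerD.
Qed.

Lemma bounded_by_affine (a b : R) M u : bounded_by M u ->
  bounded_by M (fun x => u (a * x + b)).
Proof. by move=> [mu uM]; split => //; exact: (@measurable_comp_affine _ a b u mu). Qed.

Lemma bounded_by_subl (x : R) M u : bounded_by M u ->
  bounded_by M (fun t => u (x - t)).
Proof.
move=> /(bounded_by_affine (-1) x) [mu uM]; split.
  by under eq_fun do rewrite addrC -mulN1r.
by move=> t; move: (uM t); rewrite mulN1r addrC.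
Qed.

Lemma L1M_bounded M u g : bounded_by M u -> L1fun g -> L1fun (fun x => u x * g x).
Proof.
move=> [mu uM] ig; apply: (@L1_dominated _ (fun x => M * `|g x|)).
- by apply: measurable_funM => //; exact: L1_measurable.
- by move=> x; rewrite normrM ler_wpM2r.
- exact/L1Z/L1_norm.
Qed.

Lemma L1_subl (x : R) g : L1fun g -> L1fun (fun t => g (x - t)).
Proof.
move=> ig; have := @integrable_affine _ (-1) x g _ ig.
rewrite oppr_eq0 oner_eq0 => /(_ isT).
by under eq_fun do rewrite mulN1r addrC.
Qed.

Lemma Rintegral_subl (x : R) g : L1fun g -> \int[mu]_t g (x - t) = \int[mu]_t g t.
Proof.
move=> ig; have := @Rintegral_affine _ (-1) x g _ ig.
rewrite oppr_eq0 oner_eq0 normrN1 invr1 mul1r => /(_ isT) <-.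
by apply: eq_Rintegral => t _; rewrite mulN1r addrC.
Qed.

Lemma L1_shift (x : R) g : L1fun g -> L1fun (fun t => g (t - x)).
Proof.
move=> ig; have := @integrable_affine _ 1 (- x) g _ ig.
by rewrite oner_eq0 => /(_ isT); under eq_fun do rewrite mul1r.
Qed.

Lemma Rintegral_shift (x : R) g : L1fun g -> \int[mu]_t g (t - x) = \int[mu]_t g t.
Proof.
move=> ig; have := @Rintegral_affine _ 1 (- x) g _ ig.
rewrite oner_eq0 normr1 invr1 mul1r => /(_ isT) <-.
by apply: eq_Rintegral => t _; rewrite mul1r.
Qed.

Lemma Rintegral_bounded M u g : bounded_by M u -> L1fun g ->
  `|\int[mu]_t (u t * g t)| <= M * \int[mu]_t `|g t|.
Proof.
move=> uM ig; rewrite -RintegralZl//; last exact: L1_norm.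
apply: (le_trans (le_normr_Rintegral _ (L1M_bounded uM ig))) => //.
apply: le_Rintegral => //.
- exact/L1_norm/(L1M_bounded uM).
- exact/L1Z/L1_norm.
- by move=> t _; rewrite normrM ler_wpM2r//; case: uM.
Qed.

(** The majorant [a] makes the iterated integral of the absolute value finite. All sections are
    asked to be integrable, so that each real inner integral is the extended one and not the default
    that [fine] gives to infinity. *)
Lemma Rfubini (H : R * R -> R) (a : R -> R) : measurable_fun setT H ->
  (forall x, L1fun (fun y => H (x, y))) -> (forall y, L1fun (fun x => H (x, y))) ->
  L1fun a -> (forall x, \int[mu]_y `|H (x, y)| <= a x) ->
  \int[mu]_x \int[mu]_y H (x, y) = \int[mu]_y \int[mu]_x H (x, y).
Proof.
move=> mH iH1 iH2 ia Ha; congr fine.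
have mEH : measurable_fun setT (EFin \o H) by exact/measurable_EFinP.
have iH : (mu \x mu)%E.-integrable setT (EFin \o H).
  apply/(@integrable12ltyP _ _ (measurableTypeR R) (measurableTypeR R) R) => //.
  apply: (@le_lt_trans _ _ (\int[mu]_x (a x)%:E)%E); last first.
    by rewrite ltey_eq integrable_fin_num.
  apply: ge0_le_integral => //.
  - by move=> x _; exact: integral_ge0.
  - apply: (@measurable_fun_fubini_tonelli_F _ _ (measurableTypeR R)
      (measurableTypeR R) R mu (fun z => `|(H z)%:E|%E)) => //.
    exact: measurableT_comp.
  - by case/integrableP: ia.
  - move=> x _; have := Ha x; rewrite -lee_fin /Rintegral fineK//.
    exact: (integrable_fin_num _ (L1_norm (iH1 x))).
transitivity (\int[mu]_x \int[mu]_y (H (x, y))%:E)%E.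
  apply: eq_integral => x _; rewrite /Rintegral fineK//.
  exact: (integrable_fin_num _ (iH1 x)).
rewrite (@Fubini _ _ (measurableTypeR R) (measurableTypeR R) R mu mu (EFin \o H) iH).
apply: eq_integral => y _; rewrite /Rintegral fineK//.
exact: (integrable_fin_num _ (iH2 y)).
Qed.

Lemma L1_conv_integrand M g u x : L1fun g -> bounded_by M u ->
  L1fun (fun t => u (x - t) * g t).
Proof. by move=> ig uM; exact: (L1M_bounded (bounded_by_subl x uM)). Qed.

Lemma conv_bounded M g u : L1fun g -> bounded_by M u ->
  bounded_by (M * \int[mu]_t `|g t|) (convolution g u).
Proof.
move=> ig uM; split; first by apply: measurable_convolution; [exact: L1_measurable|case: uM].
by move=> x; exact: (Rintegral_bounded (bounded_by_subl x uM)).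
Qed.

Lemma convD M N g u v : L1fun g -> bounded_by M u -> bounded_by N v ->
  convolution g (fun x => u x + v x) = (fun x => convolution g u x + convolution g v x).
Proof.
move=> ig uM vN; apply/funext => x; rewrite /convolution.
under eq_Rintegral do rewrite mulrDl.
by rewrite RintegralD//; [exact: (L1_conv_integrand _ ig uM)|exact: (L1_conv_integrand _ ig vN)].
Qed.

Lemma convZ M g u c : L1fun g -> bounded_by M u ->
  convolution g (fun x => c * u x) = (fun x => c * convolution g u x).
Proof.
move=> ig uM; apply/funext => x; rewrite /convolution.
under eq_Rintegral do rewrite -mulrA.
by rewrite RintegralZl//; exact: (L1_conv_integrand _ ig uM).
Qed.

Lemma convB M N g u v : L1fun g -> bounded_by M u -> bounded_by N v ->
  convolution g (fun x => u x - v x) = (fun x => convolution g u x - convolution g v x).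
Proof.
move=> ig uM vN; apply/funext => x; rewrite /convolution.
under eq_Rintegral do rewrite mulrBl.
by rewrite RintegralB//; [exact: (L1_conv_integrand _ ig uM)|exact: (L1_conv_integrand _ ig vN)].
Qed.

Lemma convBl M g h u : L1fun g -> L1fun h -> bounded_by M u ->
  convolution (fun x => g x - h x) u = (fun x => convolution g u x - convolution h u x).
Proof.
move=> ig ih uM; apply/funext => x; rewrite /convolution.
under eq_Rintegral do rewrite mulrBr.
by rewrite RintegralB//; [exact: (L1_conv_integrand _ ig uM)|exact: (L1_conv_integrand _ ih uM)].
Qed.

Lemma convZl M c g u : L1fun g -> bounded_by M u ->
  convolution (fun x => c * g x) u = (fun x => c * convolution g u x).
Proof.
move=> ig uM; apply/funext => x; rewrite /convolution.
under eq_Rintegral do rewrite mulrCA.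
by rewrite RintegralZl//; exact: (L1_conv_integrand _ ig uM).
Qed.

Lemma conv_reflect M g u x : L1fun g -> bounded_by M u ->
  convolution g u x = \int[mu]_t (u t * g (x - t)).
Proof.
move=> ig uM; rewrite -[RHS](Rintegral_subl x).
  by apply: eq_Rintegral => t _; rewrite subKr.
by apply: (L1M_bounded uM); exact: L1_subl.
Qed.

Lemma measurable_conv_kernel g u x : measurable_fun setT g -> measurable_fun setT u ->
  measurable_fun setT (fun z : R * R => u (x - z.1 - z.2) * g z.2).
Proof.
move=> mg mu'; apply: measurable_funM; last exact: (measurableT_comp mg).
apply: (measurableT_comp mu'); apply: measurable_funB => //.
exact: measurable_funB.
Qed.

(** Fubini swaps the two operators directly, so that the convolution of the kernels [g] and [h] need
    not be formed. *)
Lemma convCA M g h u : L1fun g -> L1fun h -> bounded_by M u ->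
  convolution g (convolution h u) = convolution h (convolution g u).
Proof.
move=> ig ih uM; apply/funext => x.
pose H (z : R * R) := u (x - z.1 - z.2) * h z.2 * g z.1.
have mH : measurable_fun setT H.
  apply: measurable_funM; last exact: (measurableT_comp (L1_measurable ig)).
  by apply: measurable_conv_kernel; [exact: L1_measurable|case: uM].
have iH1 t : L1fun (fun s => H (t, s)).
  rewrite /H/=; under eq_fun do rewrite mulrC.
  exact/L1Z/(L1_conv_integrand _ ih uM).
have iH2 s : L1fun (fun t => H (t, s)).
  rewrite /H/=; under eq_fun do rewrite [u _ * _]mulrC -mulrA.
  by apply: L1Z; under eq_fun do rewrite addrAC; exact: (L1_conv_integrand _ ig uM).
transitivity (\int[mu]_t \int[mu]_s H (t, s)).
  apply: eq_Rintegral => t _; rewrite /H/= RintegralZr//.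
  exact: (L1_conv_integrand _ ih uM).
rewrite (@Rfubini H (fun t => (M * \int[mu]_s `|h s|) * `|g t|))//.
- apply: eq_Rintegral => s _; rewrite /convolution -RintegralZr//; last first.
    exact: (L1_conv_integrand _ ig uM).
  apply: eq_Rintegral => t _; rewrite /H/= [x - t - s]addrAC.
  by rewrite mulrAC.
- exact/L1Z/L1_norm.
- move=> t; rewrite -RintegralZl//; last exact: L1_norm.
  rewrite -RintegralZr//; last exact/L1Z/L1_norm.
  apply: le_Rintegral => //.
  + exact/L1_norm.
  + by under eq_fun do rewrite mulrC; exact/L1Z/L1Z/L1_norm.
  + move=> s _; rewrite /H/= !normrM ler_wpM2r// ler_wpM2r//.
    by case: uM.
Qed.

(** The L1 modulus of continuity of [K]. The error terms below are integrals of it against the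
    absolute value of a kernel. *)
Definition modulus K (t : R) : R := \int[mu]_s `|K (s - t) - K s|.

Lemma modulus_ge0 K t : 0 <= modulus K t.
Proof. exact: Rintegral_ge0. Qed.

Lemma modulus_le K t : L1fun K -> modulus K t <= 2 * \int[mu]_s `|K s|.
Proof.
move=> iK; have iKt := L1_shift t iK.
rewrite mulr_natl mulr2n -{1}(Rintegral_shift t (L1_norm iK)) -RintegralD//.
- apply: le_Rintegral => //; [exact/L1_norm/L1B|exact/L1D/L1_norm/iK/L1_norm|].
  by move=> s _; exact: ler_normB.
- exact: L1_norm.
- exact: L1_norm.
Qed.

(** A dilation that preserves the integral only rescales the translation, so a wide kernel has a
    small modulus as soon as translations of [K] are continuous at 0. *)
Lemma modulus_affine K (a t : R) : 0 < a -> L1fun K ->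
  modulus (fun x => a * K (a * x)) t = modulus K (a * t).
Proof.
move=> a0 iK; have a0' : a != 0 by rewrite gt_eqF.
rewrite /modulus.
have iN : L1fun (fun s => `|K (s - a * t) - K s|).
  by apply/L1_norm/L1B => //; exact: L1_shift.
have := Rintegral_affine 0 a0' iN; rewrite (gtr0_norm a0) => /(congr1 (fun y => a * y)).
rewrite mulrA mulfV// mul1r => <-; rewrite -RintegralZl//; last first.
  exact: (integrable_affine 0 a0' iN).
by apply: eq_Rintegral => s _; rewrite addr0 -mulrBr normrM (gtr0_norm a0) mulrBr.
Qed.

Lemma measurable_modulus K : L1fun K -> measurable_fun setT (modulus K).
Proof.
move=> iK; have mK := L1_measurable iK.
have mH : measurable_fun setT (fun z : R * R => `|K (z.2 - z.1) - K z.2|).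
  apply: measurableT_comp => //; apply: measurable_funB.
    by apply: (measurableT_comp mK); exact: measurable_funB.
  exact: (measurableT_comp mK).
have mEH : measurable_fun setT (fun z : R * R => (`|K (z.2 - z.1) - K z.2|)%:E).
  exact/measurable_EFinP.
have mF := @measurable_fun_fubini_tonelli_F _ _ (measurableTypeR R)
  (measurableTypeR R) R mu _ mEH (fun z => normr_ge0 _).
exact: (measurableT_comp (fine_measurable measurableT) mF).
Qed.

Lemma bounded_modulus K : L1fun K ->
  bounded_by (2 * \int[mu]_s `|K s|) (modulus K).
Proof.
move=> iK; split; first exact: measurable_modulus.
by move=> t; rewrite ger0_norm ?modulus_ge0 ?modulus_le.
Qed.

(* Moving the translation of [convolution K u] onto [K] needs no Fubini. *)
Lemma conv_modulus M g K u x : L1fun g -> L1fun K -> bounded_by M u ->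
  `|convolution g (convolution K u) x - (\int[mu]_t g t) * convolution K u x|
  <= M * \int[mu]_t (modulus K t * `|g t|).
Proof.
move=> ig iK uM; have cM := conv_bounded iK uM.
have M0 := bounded_by_ge0 uM.
rewrite {1}/convolution -RintegralZr// -RintegralB//; last 2 first.
- exact: (L1_conv_integrand _ ig cM).
- by under eq_fun do rewrite mulrC; exact: L1Z.
have iw : L1fun (fun t => modulus K t * `|g t|).
  exact: (L1M_bounded (bounded_modulus iK) (L1_norm ig)).
have iD : L1fun (fun t => convolution K u (x - t) * g t - g t * convolution K u x).
  apply: L1B; first exact: (L1_conv_integrand _ ig cM).
  by under eq_fun do rewrite mulrC; exact: L1Z.
rewrite -RintegralZl//; apply: (le_trans (le_normr_Rintegral _ iD)) => //.
apply: le_Rintegral => //; [exact: L1_norm|exact: L1Z|move=> t _].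
rewrite [g t * _]mulrC -mulrBl normrM mulrA ler_wpM2r//.
rewrite !(conv_reflect _ iK uM) -RintegralB//; last 2 first.
- by apply: (L1M_bounded uM); exact: L1_subl.
- by apply: (L1M_bounded uM); exact: L1_subl.
under eq_Rintegral do rewrite -mulrBr.
apply: (le_trans (Rintegral_bounded uM _)).
  by apply: L1B; exact: L1_subl.
rewrite ler_wpM2l// /modulus -[leRHS](Rintegral_subl x).
  by rewrite le_eqVlt; apply/orP; left; apply/eqP/eq_Rintegral => y _; rewrite addrAC.
by apply/L1_norm/L1B => //; exact: L1_shift.
Qed.

End convolution_theory.
Notation L1fun g := (lebesgue_measure.-integrable setT (EFin \o (g : _ -> _))).

(** * Continuity of translations in the mean *)

Section translation_continuity.
Context {R : realType}.
Local Notation mu := (@lebesgue_measure R).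
Implicit Types (f g h u v K : R -> R).

Lemma L1_indic K (A : set R) : measurable A -> L1fun K ->
  L1fun (fun x => K x * \1_A x).
Proof.
move=> mA iK; under eq_fun do rewrite mulrC.
apply: (@L1M_bounded _ 1) => //; split; first exact: measurable_indic.
by move=> x; rewrite indicE; case: (x \in A); rewrite ?normr1 ?normr0.
Qed.

Lemma Rdominated_convergence (F : nat -> R -> R) (G D : R -> R) :
  (forall n, measurable_fun setT (F n)) -> measurable_fun setT G ->
  {ae mu, forall x, F n x @[n --> \oo] --> G x} -> L1fun D ->
  (forall n x, `|F n x| <= D x) ->
  \int[mu]_x `|F n x - G x| @[n --> \oo] --> 0.
Proof.
move=> mF mG FG iD FD.
have [] := @dominated_convergence _ _ R mu setT measurableT (fun n => EFin \o F n)
  (EFin \o G) (EFin \o D).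
- by move=> n; apply/measurable_EFinP; exact: mF.
- exact/measurable_EFinP.
- apply: (@filterS _ _ (ae_filter_ringOfSetsType mu) _ _ _ FG) => x FGx _.
  by apply/fine_cvgP; split => //=; exact: nearW.
- by [].
- by apply: aeW => x n _; rewrite lee_fin.
move=> _ /fine_cvgP[_ H] _; apply: cvg_trans H; apply: near_eq_cvg.
apply: nearW => n. done.
Qed.

Lemma L1_approx_bounded_support K (e : R) : L1fun K -> 0 < e ->
  exists n : nat, \int[mu]_x `|K x * \1_(`[- n%:R, n%:R]) x - K x| < e.
Proof.
move=> iK e0.
have mI n : measurable_fun setT (fun x => K x * \1_(`[- n%:R, n%:R]) x).
  by apply: L1_measurable; exact: L1_indic.
have H : \int[mu]_x `|K x * \1_(`[- n%:R, n%:R]) x - K x| @[n --> \oo] --> 0.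
  apply: (@Rdominated_convergence (fun n x => K x * \1_(`[- n%:R, n%:R]) x) K (fun x => `|K x|)) => //.
  - exact: L1_measurable.
  - apply: aeW => x; apply: cvg_near_cst; near=> n.
    rewrite indicE mem_set ?mulr1//= in_itv/= -ler_norml.
    by near: n; exact: nbhs_infty_ger.
  - exact: L1_norm.
  - move=> n x; rewrite normrM ler_piMr// indicE.
    by case: (x \in _); rewrite ?normr1 ?normr0.
move/cvgrPdist_lt : H => /(_ _ e0)[n _ /(_ n (leqnn n))].
by rewrite sub0r normrN ger0_norm ?Rintegral_ge0//; exists n.
Unshelve. all: end_near. Qed.

(** Restriction to a bounded interval comes first because the continuous approximation is taken on a
    set of finite measure. The cut-off stays in the result, as [g] itself may fail to be
    integrable. *)
Lemma L1_approx_continuous K (e : R) : L1fun K -> 0 < e ->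
  exists g (n : nat),
  [/\ continuous g, L1fun (fun x => g x * \1_(`[- n%:R, n%:R]) x) &
  \int[mu]_x `|K x - g x * \1_(`[- n%:R, n%:R]) x| < e].
Proof.
move=> iK e0; have e20 : 0 < e / 2 by rewrite divr_gt0.
have [n Kn] := L1_approx_bounded_support iK e20.
have mE : measurable (`[- n%:R, n%:R] : set R) by exact: measurable_itv.
have iKE : mu.-integrable `[- n%:R, n%:R] (EFin \o K) by exact: integrableS iK.
have mEoo : (mu [set` `[- n%:R, n%:R]%R] < +oo)%E.
  by rewrite /= lebesgue_measure_itv/=; case: ifP; rewrite -?EFinB ltry.
have [g_ [cg ig]] := @approximation_continuous_integrable R _ K mE mEoo iKE.
move=> /fine_cvgP[_ /cvgrPdist_lt /(_ _ e20)[m _ /(_ m (leqnn m))]].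
rewrite sub0r normrN => Hm.
have igE : L1fun (fun x => g_ m x * \1_(`[- n%:R, n%:R]) x).
  have := (@integrable_mkcond _ _ R mu _ (EFin \o g_ m) mE).1 (ig m); congr (_.-integrable _ _).
  apply/funext => x; rewrite /= patchE indicE.
  by case: (x \in _); rewrite ?mulr1 ?mulr0.
have iKE' := L1_indic mE iK.
exists (g_ m), n; split => //.
apply: (@le_lt_trans _ _ (\int[mu]_x `|K x * \1_(`[- n%:R, n%:R]) x - K x| +
    \int[mu]_x `|K x * \1_(`[- n%:R, n%:R]) x - g_ m x * \1_(`[- n%:R, n%:R]) x|)).
  rewrite -RintegralD//; [|exact/L1_norm/L1B|exact/L1_norm/L1B].
  apply: le_Rintegral => //; [exact/L1_norm/L1B|by apply/L1D; exact/L1_norm/L1B|].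
  by move=> x _; rewrite [X in _ <= X + _]distrC; exact: ler_distD.
rewrite [ltRHS]splitr ltrD//.
apply: le_lt_trans Hm; rewrite ger0_norm; last exact: Rintegral_ge0.
rewrite le_eqVlt; apply/orP; left; apply/eqP.
rewrite [RHS]Rintegral_mkcond; apply: eq_Rintegral => x _.
rewrite -mulrBl patchE indicE; case: (x \in _); rewrite ?mulr1 ?mulr0 ?normr0//.
Qed.

(** The cut-off function may jump at the two end points; elsewhere it is locally [g] or 0, and two
    points form a null set. *)
Lemma modulus_cvg0_continuous g (n : nat) (s : nat -> R) : continuous g ->
  L1fun (fun x => g x * \1_(`[- n%:R, n%:R]) x) ->
  s m @[m --> \oo] --> 0 ->
  modulus (fun x => g x * \1_(`[- n%:R, n%:R]) x) (s m) @[m --> \oo] --> 0.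
Proof.
move=> cg iK s0; set K := (fun x => _) in iK *.
have [B KB] : exists B, forall x, `|K x| <= B.
  have : compact (g @` `[- n%:R, n%:R]).
    apply: continuous_compact; last exact: segment_compact.
    exact: continuous_subspaceT.
  move=> /compact_bounded[B [_ HB]]; exists (`|B| + 1) => x.
  rewrite /K indicE; case: (boolP (x \in _)) => [|_]; last first.
    by rewrite mulr0 normr0 addr_ge0.
  move/set_mem => xI; rewrite mulr1; apply: HB; last by exists x.
  by rewrite (le_lt_trans (ler_norm B))// ltrDl.
have B0 : 0 <= B by rewrite (le_trans _ (KB 0)).
have [S sS] : exists S, forall m, `|s m| <= S.
  have /cvg_seq_bounded[S [_ HS]] : cvgn s by apply/cvg_ex; exists 0.
  exists (`|S| + 1) => m; apply: HS => //.
  by rewrite (le_lt_trans (ler_norm S))// ltrDl.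
have S0 : 0 <= S by rewrite (le_trans _ (sS 0%N)).
have Kcvg (x : R) : x <> n%:R -> x <> - n%:R -> K (x - s m) @[m --> \oo] --> K x.
  move=> xn xNn.
  have sx : x - s m @[m --> \oo] --> x.
    by rewrite -[X in _ --> X]subr0; apply: (@cvgB _ _ _ _ _ (fun=> x) s); [exact: cvg_cst|exact: s0].
  have Kin (y : R) : `|y| < n%:R -> K y = g y.
    by move=> yn; rewrite /K indicE mem_set ?mulr1//= in_itv/= -ler_norml ltW.
  have Kout (y : R) : n%:R < `|y| -> K y = 0.
    move=> yn; rewrite /K indicE memNset ?mulr0//= in_itv/= -ler_norml.
    by apply/negP; rewrite -ltNge.
  have [xin|xout] := ltP `|x| n%:R.
    rewrite (Kin x xin); apply: (@cvg_trans _ (g (x - s m) @[m --> \oo])).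
      by apply: near_eq_cvg; near=> m; rewrite Kin//; near: m; exact: cvgr_norm_lt sx _ xin.
    by apply: continuous_cvg => //; exact: cg.
  have {}xout : n%:R < `|x|.
    rewrite lt_neqAle xout andbT; apply/eqP => nx.
    have [x0|x0] := leP 0 x.
      by apply: xn; rewrite nx ger0_norm.
    by apply: xNn; rewrite nx ltr0_norm ?opprK.
  rewrite (Kout x xout); apply: cvg_near_cst; near=> m; rewrite Kout//.
  by near: m; exact: cvgr_norm_gt sx _ xout.
rewrite /modulus.
(* Since [|s m| <= S], all translates are supported in this larger interval, which gives one
   integrable majorant. *)
pose D x := B * \1_(`[- (n%:R + S), n%:R + S]) x.
apply: (@Rdominated_convergence (fun m x => K (x - s m)) K D).
- by move=> m; apply: L1_measurable; exact: L1_shift.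
- exact: L1_measurable.
- exists ([set n%:R] `|` [set - n%:R]); split.
  + by apply: measurableU; exact: measurable_set1.
  + by apply: null_set_setU; try exact: lebesgue_measure_set1; exact: measurable_set1.
  + move=> x /= H; apply: contrapT => /not_orP[xn xNn]; apply: H.
    exact: Kcvg.
- by apply: L1Z; exact: (@integrable_indic_itv R (- (n%:R + S)) (n%:R + S) true false).
- move=> m x; rewrite /D indicE; have [xin|xout] := boolP (x \in _).
    by rewrite mulr1.
  rewrite mulr0 /K indicE memNset ?mulr0 ?normr0//= => xin.
  move/negP : xout; apply; apply/mem_set; move: xin => /=.
  rewrite !in_itv/= -!ler_norml => xin.
  rewrite -[x](subrK (s m)) (le_trans (ler_normD _ _))// lerD//.
Unshelve. all: end_near. Qed.

Lemma L1_translation_continuous K (s : nat -> R) : L1fun K ->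
  s m @[m --> \oo] --> 0 -> modulus K (s m) @[m --> \oo] --> 0.
Proof.
move=> iK s0; apply/cvgrPdist_lt => e e0.
(* The error [K - G] counts twice through [modulus_le] and [G] once, for a total below
   [3 * e / 4]. *)
have e40 : 0 < e / 4 by rewrite divr_gt0.
have [g [n [cg iG Kg]]] := L1_approx_continuous iK e40.
set G := (fun x => g x * \1_(`[- n%:R, n%:R]) x) in iG Kg.
have iKG := L1B iK iG.
have /cvgrPdist_lt /(_ _ e40) := modulus_cvg0_continuous cg iG s0.
apply: filterS => m; rewrite !sub0r !normrN !(ger0_norm (modulus_ge0 _ _)) -/G => Gm.
apply: (@le_lt_trans _ _ (modulus (fun x => K x - G x) (s m) + modulus G (s m))).
  have i1 (t : R) (F : R -> R) : L1fun F -> L1fun (fun x : R => `|F (x - t) - F x|).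
    by move=> iF; apply/L1_norm/L1B => //; exact: L1_shift.
  rewrite /modulus -RintegralD//; [|exact: (i1 (s m) (fun x => K x - G x) iKG)|exact: i1].
  apply: le_Rintegral => //; [exact: i1|by apply: L1D; [exact: (i1 (s m) (fun x => K x - G x) iKG)|exact: i1]|].
  move=> x _; rewrite (le_trans _ (ler_normD _ _))//.
  by rewrite le_eqVlt; apply/orP; left; apply/eqP; congr `|_|; ring.
have := modulus_le (s m) iKG; lra.
Qed.

(** Continuity of translations gives the pointwise limit 0, and the boundedness of the modulus gives
    a multiple of [|g|] as majorant. *)
Lemma L1_modulus_cvg0 K g (a : nat -> R) : L1fun K -> L1fun g ->
  a m @[m --> \oo] --> 0 ->
  \int[mu]_t (modulus K (a m * t) * `|g t|) @[m --> \oo] --> 0.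
Proof.
move=> iK ig a0.
have [mM MB] := bounded_modulus iK.
have mF m : measurable_fun setT (fun t => modulus K (a m * t) * `|g t|).
  apply: measurable_funM; last by apply: measurableT_comp => //; exact: L1_measurable.
  by apply: (measurableT_comp mM); exact: measurable_funM.
have := @Rdominated_convergence (fun m t => modulus K (a m * t) * `|g t|) (cst 0)
  (fun t => (2 * \int[mu]_s `|K s|) * `|g t|) mF.
move=> /(_ (measurable_cst _)) H.
suff : \int[mu]_x `|modulus K (a m * x) * `|g x| - cst 0 x| @[m --> \oo] --> 0.
  apply: cvg_trans; apply: near_eq_cvg; apply: nearW => m.
  by apply: eq_Rintegral => t _; rewrite subr0 ger0_norm// mulr_ge0// modulus_ge0.
apply: H.
- apply: aeW => t; rewrite -[X in _ --> X](mul0r `|g t|).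
  apply: cvgMl; apply: L1_translation_continuous => //.
  by rewrite -[X in _ --> X](mul0r t); apply: cvgMl.
- exact/L1Z/L1_norm.
- by move=> m t; rewrite normrM normr_id ler_wpM2r.
Qed.

End translation_continuity.

(** * Fejer and de la Vallee-Poussin kernels *)

Section fejer_kernel.
Context {R : realType}.
Local Notation mu := (@lebesgue_measure R).
Implicit Types (d x xi : R).

Lemma L1_oneDsqrV : L1fun (fun x : R => (oneDsqr x)^-1).
Proof.
have m : measurable_fun [set: R] (fun x : R => (oneDsqr x)^-1).
  by apply: continuous_measurable_fun; exact: continuous_oneDsqrV.
apply/integrableP; split; first by apply/measurable_EFinP.
under eq_integral do rewrite /= ger0_norm ?invr_ge0//.
rewrite (@ge0_symfun_integralT R (fun x : R => (oneDsqr x)^-1)).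
- by rewrite -set_itvcy integral0y_oneDsqr -EFinM ltry.
- by move=> x; rewrite invr_ge0.
- exact: continuous_oneDsqrV.
- by move=> x /=; rewrite /oneDsqr sqrrN.
Qed.

(** The Fejer kernel up to a constant: for [d >= 0] its Fourier transform is [fejer_mass] times the
    positive part of [d - |xi|]. Without a normalising factor in [d], its second differences in [d]
    are again a kernel times a cosine. At 0 the division convention gives 0 in place of
    [d ^+ 2 / 2]. *)
Definition fejer d x : R := (1 - cos (d * x)) / x ^+ 2.

Lemma fejer_ge0 d x : 0 <= fejer d x.
Proof. by rewrite divr_ge0 ?sqr_ge0// subr_ge0 cos_le1. Qed.

Lemma fejerN d x : fejer (- d) x = fejer d x.
Proof. by rewrite /fejer mulNr cosN. Qed.

Lemma fejer_even d x : fejer d (- x) = fejer d x.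
Proof. by rewrite /fejer mulrN cosN sqrrN. Qed.

Lemma fejer0 x : fejer 0 x = 0.
Proof. by rewrite /fejer mul0r cos0 subrr mul0r. Qed.

Lemma measurable_fejer d : measurable_fun [set: R] (fejer d).
Proof.
have m0 : measurable [set (0 : R)] by exact: measurable_set1.
rewrite -(setvU [set (0 : R)]).
apply: (measurable_funU _ (measurableC m0) m0).2.
split; last exact: measurable_fun_set1.
apply: open_continuous_measurable_fun.
  by apply: closed_openC; exact: closed_eq.
move=> x /set_mem/= /eqP x0; apply: cvgM.
  apply: cvgB; first exact: cvg_cst.
  apply: continuous_comp; last exact: continuous_cos.
  by apply: cvgM; [exact: cvg_cst|exact: cvg_id].
by apply: cvgV; [rewrite expf_neq0|exact: exprn_continuous].
Qed.

(** The kernel as the cosine transform of a triangle. This yields the bound near 0 and, through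
    Fubini, the reproducing identity. *)
Lemma fejerE d x : 0 < d -> x != 0 ->
  fejer d x = \int[mu]_(xi in `[0, d]) ((d - xi) * cos (xi * x)).
Proof.
move=> d0 x0.
(* An antiderivative in [xi], from integration by parts. *)
pose F xi : R := (d - xi) * (sin (xi * x) / x) - cos (xi * x) / x ^+ 2.
have dF xi : is_derive xi 1 F ((d - xi) * cos (xi * x)).
  have hx : is_derive xi (1 : R) (fun y : R => y * x) x.
    have -> : (fun y : R => y * x) = x \*: id by apply/funext => y; rewrite /= mulrC.
    by apply: is_derive_eq; rewrite -[LHS]/(_ * _) mulr1.
  have hs : is_derive xi (1 : R) (@sin R \o (fun y : R => y * x)) (cos (xi * x) * x).
    exact: is_derive1_comp.
  have hc : is_derive xi (1 : R) (@cos R \o (fun y : R => y * x)) (- sin (xi * x) * x).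
    exact: is_derive1_comp.
  have -> : F = (cst d - id) * (x^-1 \*: (@sin R \o (fun y : R => y * x)))
      - (x ^+ 2)^-1 \*: (@cos R \o (fun y : R => y * x)).
    by apply/funext => y; rewrite /F /= !fctE/= -![_ *: _]/(_ * _); ring.
  apply: is_derive_eq; rewrite /= !fctE /= -![_ *: _]/(_ * _).
  by field.
have cF : continuous F.
  by move=> xi; apply: differentiable_continuous; apply/derivable1_diffP; case: (dF xi).
rewrite /Rintegral (@continuous_FTC2 _ _ F)//.
- by rewrite /F subrr !mul0r sin0 cos0 /fejer/=; field.
- apply: continuous_subspaceT => xi; apply: cvgM.
    by apply: cvgB; [exact: cvg_cst|exact: cvg_id].
  apply: continuous_comp; last exact: continuous_cos.
  by apply: cvgM; [exact: cvg_id|exact: cvg_cst].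
- split.
  + by move=> xi _; case: (dF xi).
  + by apply: cvg_at_right_filter; exact: cF.
  + by apply: cvg_at_left_filter; exact: cF.
- by move=> xi _; rewrite derive1E; case: (dF xi).
Qed.

(** The product of the kernel with [x ^+ 2] is at most 2, which controls infinity; the integral
    formula bounds the kernel by [d ^+ 2], which controls the origin. *)
Lemma fejer_le d x : 0 < d -> fejer d x <= (2 + d ^+ 2) * (oneDsqr x)^-1.
Proof.
move=> d0; rewrite ler_pdivlMr ?oneDsqr_gt0// /oneDsqr mulrDr mulr1 addrC lerD//.
  have [->|x0] := eqVneq x 0; first by rewrite expr0n mulr0.
  by rewrite /fejer divfK ?expf_neq0// lerBlDl -lerBlDr (le_trans _ (cos_geN1 _))//; lra.
have [->|x0] := eqVneq x 0.
  by rewrite /fejer expr0n invr0 mulr0 sqr_ge0.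
rewrite fejerE//.
have icst : mu.-integrable `[0, d] (EFin \o cst d).
  apply: continuous_compact_integrable; first exact: segment_compact.
  by apply: continuous_subspaceT => xi; exact: cvg_cst.
apply: (@le_trans _ _ (\int[mu]_(xi in `[0, d]) cst d xi)); last first.
  by rewrite Rintegral_cst//= lebesgue_measure_itv/= lte_fin d0 sube0/= expr2.
have ib : mu.-integrable `[0, d] (EFin \o (fun xi => (d - xi) * cos (xi * x))).
  apply: continuous_compact_integrable; first exact: segment_compact.
  apply: continuous_subspaceT => xi; apply: cvgM.
    by apply: cvgB; [exact: cvg_cst|exact: cvg_id].
  apply: continuous_comp; last exact: continuous_cos.
  by apply: cvgM; [exact: cvg_id|exact: cvg_cst].
apply: le_Rintegral => // xi /=; rewrite in_itv/= => /andP[xi0 xid].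
rewrite (le_trans (ler_norm _))// normrM ger0_norm ?subr_ge0//.
rewrite -[leRHS]mulr1 ler_pM ?subr_ge0 ?cos_max//.
by rewrite lerBlDr lerDl.
Qed.

Lemma L1_fejer d : L1fun (fejer d).
Proof.
have pos e : 0 < e -> L1fun (fejer e).
  move=> e0; apply: (@L1_dominated _ _ (fun x => (2 + e ^+ 2) * (oneDsqr x)^-1)).
  - exact: measurable_fejer.
  - by move=> x; rewrite ger0_norm ?fejer_ge0 ?fejer_le.
  - exact/L1Z/L1_oneDsqrV.
have [d0|d0|->] := ltgtP d 0.
- have -> : fejer d = fejer (- d) by apply/funext => x; rewrite fejerN.
  by apply: pos; rewrite oppr_gt0.
- exact: pos.
- have -> : fejer 0 = cst 0 by apply/funext => x; rewrite fejer0.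
  exact: integrable0.
Qed.

Lemma fejer_scale d x : fejer d x = d ^+ 2 * fejer 1 (d * x).
Proof.
have [->|d0] := eqVneq d 0; first by rewrite fejer0 expr0n mul0r.
have [->|x0] := eqVneq x 0; first by rewrite /fejer mulr0 expr0n/= invr0 !mulr0.
by rewrite /fejer mul1r; field; rewrite d0 x0.
Qed.

(** The constant is pi. It is carried as a symbol: the argument divides by it but does not evaluate
    it. *)
Definition fejer_mass : R := \int[mu]_x fejer 1 x.

Lemma Rintegral_fejer d : \int[mu]_x fejer d x = `|d| * fejer_mass.
Proof.
have [->|d0] := eqVneq d 0.
  by rewrite normr0 mul0r; under eq_Rintegral do rewrite fejer0; rewrite Rintegral_cst// mul0r.
under eq_Rintegral do rewrite fejer_scale -[d * _]addr0.
rewrite RintegralZl//; last exact: (integrable_affine 0 d0 (L1_fejer 1)).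
rewrite (Rintegral_affine 0 d0 (L1_fejer 1)) mulrA; congr (_ * _).
rewrite -real_normK ?num_real// expr2 mulfK// normr_eq0//.
Qed.

Lemma fejer_mass_gt0 : 0 < fejer_mass.
Proof.
have pi2 := @pi_ge2 R.
have c1 : cos 1 < 1 :> R.
  rewrite -[ltRHS]cos0 ltr_cos//; rewrite in_itv/= ?lexx ?pi_ge0//.
  by rewrite ler01/=; lra.
(* On [[1, 2]] the cosine is at most [cos 1], because it decreases up to [pi >= 2], and [x ^+ 2] is
   at most 4. *)
have c0 : 0 < (1 - cos 1) / 4 :> R by rewrite divr_gt0// subr_gt0.
apply: (lt_le_trans c0); rewrite /fejer_mass.
have i12 : L1fun (fun x : R => (1 - cos 1) / 4 * \1_(`[1, 2]) x).
  by apply: L1Z; exact: (@integrable_indic_itv R 1 2 true false).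
apply: (@le_trans _ _ (\int[mu]_x ((1 - cos 1) / 4 * \1_(`[1, 2]) x))).
  rewrite RintegralZl//; last exact: (@integrable_indic_itv R 1 2 true false).
  rewrite /Rintegral integral_indic ?setIT; [|exact: measurableT|exact: measurable_itv].
  rewrite -[X in fine X]/(mu [set` `[1, 2]]) lebesgue_measure_itv/= lte_fin ltr1n/=.
  lra.
apply: le_Rintegral => //; first exact: L1_fejer.
move=> x _; rewrite indicE; case: (boolP (x \in _)) => [|_]; last first.
  by rewrite mulr0 fejer_ge0.
move=> /set_mem/=; rewrite in_itv/= mulr1 => /andP[x1 x2].
rewrite /fejer mul1r ler_pM ?invr_ge0 ?subr_ge0 ?cos_le1//.
  rewrite lerD2l lerN2 le_eqVlt; have [->|x1'] := eqVneq x 1; first by rewrite eqxx.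
  apply/orP; right; rewrite ltr_cos ?in_itv/= ?ler01/=; [|lra|lra].
  by rewrite lt_neqAle eq_sym x1'.
rewrite lef_pV2 ?posrE//; first by nra.
by rewrite exprn_gt0// (lt_le_trans _ x1).
Qed.

(** The Vallee-Poussin kernel: for [d > 0] its Fourier transform is [fejer_mass] on [[-d, d]] and 0
    off [[-2d, 2d]]. As a difference quotient of [fejer] in the parameter, it reads off the slope of
    whatever is affine in that parameter. *)
Definition vallee d x : R := (fejer (2 * d) x - fejer d x) / d.

Lemma L1_vallee d : L1fun (vallee d).
Proof.
rewrite /vallee; under eq_fun do rewrite mulrC.
by apply: L1Z; apply: L1B; exact: L1_fejer.
Qed.

Lemma vallee_even d x : vallee d (- x) = vallee d x.
Proof. by rewrite /vallee !fejer_even. Qed.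

Lemma vallee_scale d x : d != 0 -> vallee d x = d * vallee 1 (d * x).
Proof.
move=> d0; rewrite /vallee (fejer_scale (2 * d)) (fejer_scale d).
rewrite mulr1 (fejer_scale 2) (_ : 2 * d * x = 2 * (d * x)); last by ring.
by field.
Qed.

(** Multiplication by a cosine is a second difference in the parameter. The identity first computes
    the Fourier transform of [fejer] and later localises in frequency. *)
Lemma fejerM_cos d xi x :
  fejer d x * cos (xi * x) = 2^-1 * (fejer (d + xi) x + fejer (d - xi) x) - fejer xi x.
Proof.
rewrite /fejer [(d + xi) * x]mulrDl [(d - xi) * x]mulrBl cosD cosB; have [->|x0] := eqVneq x 0.
  by rewrite expr0n invr0 !(mulr0, mul0r) addr0 subr0 mulr0.
by field.
Qed.

Lemma bounded_by_cos xi : bounded_by 1 (fun x : R => cos (xi * x)).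
Proof.
split; last by move=> x; exact: cos_max.
apply: continuous_measurable_fun => x; apply: continuous_comp; last exact: continuous_cos.
by apply: cvgM; [exact: cvg_cst|exact: cvg_id].
Qed.

Lemma bounded_by_sin xi : bounded_by 1 (fun x : R => sin (xi * x)).
Proof.
split; last by move=> x; exact: sin_max.
apply: continuous_measurable_fun => x; apply: continuous_comp; last exact: continuous_sin.
by apply: cvgM; [exact: cvg_cst|exact: cvg_id].
Qed.

Lemma L1M_cos xi (g : R -> R) : L1fun g -> L1fun (fun x => g x * cos (xi * x)).
Proof.
by move=> ig; under eq_fun do rewrite mulrC; exact: (L1M_bounded (bounded_by_cos xi)).
Qed.

Lemma L1M_sin xi (g : R -> R) : L1fun g -> L1fun (fun x => g x * sin (xi * x)).
Proof.
by move=> ig; under eq_fun do rewrite mulrC; exact: (L1M_bounded (bounded_by_sin xi)).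
Qed.

(** The three masses in [fejerM_cos] are multiples of absolute values, which combine to the
    triangle. *)
Lemma Rintegral_fejer_cos d xi : `|xi| <= d ->
  \int[mu]_x (fejer d x * cos (xi * x)) = (d - `|xi|) * fejer_mass.
Proof.
move=> xid; under eq_Rintegral do rewrite fejerM_cos.
have i1 : L1fun (fun x => fejer (d + xi) x + fejer (d - xi) x) by apply: L1D; exact: L1_fejer.
rewrite RintegralB//; [|exact: L1Z|exact: L1_fejer].
rewrite RintegralZl// RintegralD//; [|exact: L1_fejer|exact: L1_fejer].
rewrite !Rintegral_fejer; move: xid; rewrite ler_norml => /andP[xi1 xi2].
by rewrite !(@ger0_norm _ (d + _)) ?subr_ge0//; [field|lra].
Qed.

(** Up to [fejer_mass], the triangles of half-widths [2 * d] and [d] differ by the constant [d] on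
    [[-d, d]]. *)
Lemma Rintegral_vallee_cos d xi : 0 < d -> `|xi| <= d ->
  \int[mu]_x (vallee d x * cos (xi * x)) = fejer_mass.
Proof.
move=> d0 xid; rewrite /vallee.
under eq_Rintegral do rewrite mulrAC mulrBl mulrC.
have i1 e : L1fun (fun x => fejer e x * cos (xi * x)) by apply: L1M_cos; exact: L1_fejer.
rewrite RintegralZl//; last by apply: L1B.
rewrite RintegralB// !Rintegral_fejer_cos//; first by field; rewrite gt_eqF.
by rewrite (le_trans xid)//; lra.
Qed.

Lemma Rintegral_vallee d : 0 < d -> \int[mu]_x vallee d x = fejer_mass.
Proof.
move=> d0; rewrite -(@Rintegral_vallee_cos d 0)// ?normr0 ?(ltW d0)//.
by apply: eq_Rintegral => x _; rewrite mul0r cos0 mulr1.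
Qed.

Lemma Rintegral_vallee_sin d xi : \int[mu]_x (vallee d x * sin (xi * x)) = 0.
Proof.
have iV : L1fun (fun x => vallee d x * sin (xi * x)) by apply: L1M_sin; exact: L1_vallee.
have := Rintegral_subl 0 iV.
under eq_Rintegral do rewrite sub0r vallee_even mulrN sinN mulrN -mulN1r.
by rewrite RintegralZl// => ?; lra.
Qed.

Lemma Rintegral_ae_eq (g h : R -> R) : measurable_fun setT g -> measurable_fun setT h ->
  {ae mu, forall x, g x = h x} -> \int[mu]_x g x = \int[mu]_x h x.
Proof.
move=> mg mh gh; congr fine; apply: ae_eq_integral => //.
- by apply/measurable_EFinP; exact: mg.
- by apply/measurable_EFinP; exact: mh.
- by apply: (@filterS _ _ (ae_filter_ringOfSetsType mu) _ _ _ gh) => x -> _.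
Qed.

(* [t = x] is excluded because [fejer d 0] is the junk value [0]. *)
Lemma conv_vallee_fejer d x : 0 < d -> x != 0 ->
  convolution (vallee d) (fejer d) x = fejer_mass * fejer d x.
Proof.
move=> d0 x0.
pose L xi : R := (d - xi) * \1_(`[0, d]) xi.
have mx : measurable (~` [set x] : set R) by apply: measurableC; exact: measurable_set1.
have iL : L1fun L.
  apply: (@L1_dominated _ _ (fun xi => d * \1_(`[0, d]) xi)).
  - by apply: measurable_funM; [exact: measurable_funB|exact: measurable_indic].
  - move=> xi; rewrite /L indicE; case: (boolP (xi \in _)) => [|_]; last by rewrite !mulr0 normr0.
    move=> /set_mem/=; rewrite in_itv/= => /andP[? ?].
    by rewrite !mulr1 ger0_norm ?subr_ge0// lerBlDr lerDl.
  - by apply: L1Z; exact: (@integrable_indic_itv R 0 d true false).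
have fE (y : R) : y != 0 -> fejer d y = \int[mu]_xi (L xi * cos (xi * y)).
  move=> y0; rewrite fejerE// Rintegral_mkcond; apply: eq_Rintegral => xi _.
  by rewrite patchE /L indicE; case: (xi \in _); rewrite ?mulr1 ?mulr0 ?mul0r.
have iLc (y : R) : L1fun (fun xi : R => L xi * cos (xi * y)).
  by under eq_fun do rewrite [_ * y]mulrC; exact: L1M_cos.
pose V t : R := vallee d t * \1_(~` [set x]) t.
have iV : L1fun V by apply: L1_indic => //; exact: L1_vallee.
pose H (z : R * R) := L z.2 * cos (z.2 * (x - z.1)) * V z.1.
have mcos : measurable_fun setT (fun z : R * R => cos (z.2 * (x - z.1))).
  apply: (@measurableT_comp _ _ _ _ _ _ (@cos R)).
    by apply: continuous_measurable_fun; exact: continuous_cos.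
  by apply: measurable_funM => //; exact: measurable_funB.
have mH : measurable_fun setT H.
  apply: measurable_funM; last by apply: (measurableT_comp (L1_measurable iV)).
  by apply: measurable_funM => //; apply: (measurableT_comp (L1_measurable iL)).
have iH t : L1fun (fun xi => H (t, xi)).
  by rewrite /H/=; under eq_fun do rewrite mulrC; exact/L1Z/iLc.
transitivity (\int[mu]_t \int[mu]_xi H (t, xi)).
  apply: eq_Rintegral => t _; rewrite /H/= RintegralZr//.
  rewrite /V indicE; have [->|tx] := eqVneq t x.
    rewrite memNset/=; last by apply.
    by rewrite mulr0 subrr /fejer expr0n invr0 mulr0 mul0r mulr0.
  rewrite mem_set/=; last exact/eqP.
  by rewrite mulr1 -fE// subr_eq0 eq_sym.
(* The addition formula separates [x] from [t] and leaves the cosine and sine transforms of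
   [vallee d]: the first is constant on the support of [L], the second is 0. *)
have cosE xi t : cos (xi * (x - t)) = cos (xi * x) * cos (xi * t) + sin (xi * x) * sin (xi * t).
  by rewrite mulrBr cosB.
rewrite (@Rfubini _ H (fun t => (\int[mu]_xi `|L xi|) * `|V t|))//.
- rewrite fE// -RintegralZl//.
  apply: eq_Rintegral => xi _.
  transitivity (\int[mu]_t (L xi * (cos (xi * x) * (vallee d t * cos (xi * t)) +
      sin (xi * x) * (vallee d t * sin (xi * t))))).
    apply: Rintegral_ae_eq.
    + rewrite /H/=; apply: measurable_funM; last exact: L1_measurable.
      apply: measurable_funM => //; apply: (@measurableT_comp _ _ _ _ _ _ (@cos R)).
        by apply: continuous_measurable_fun; exact: continuous_cos.
      by apply: measurable_funM => //; exact: measurable_funB.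
    + apply: L1_measurable; apply: L1Z; apply: L1D; apply: L1Z.
        by apply: L1M_cos; exact: L1_vallee.
      by apply: L1M_sin; exact: L1_vallee.
    + exists [set x]; split; [exact: measurable_set1|exact: lebesgue_measure_set1|].
      move=> t /= Ht; apply: contrapT => tx; apply: Ht.
      by rewrite /H/= /V indicE mem_set//= cosE; ring.
  have i1 : L1fun (fun t => vallee d t * cos (xi * t)) by apply: L1M_cos; exact: L1_vallee.
  have i2 : L1fun (fun t => vallee d t * sin (xi * t)) by apply: L1M_sin; exact: L1_vallee.
  rewrite RintegralZl//; last by apply: L1D; exact: L1Z.
  rewrite RintegralD//; [|exact: L1Z|exact: L1Z].
  rewrite !RintegralZl// Rintegral_vallee_sin mulr0 addr0 /L indicE.
  case: (boolP (xi \in _)) => [|_]; last by rewrite !(mulr0, mul0r).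
  move=> /set_mem/=; rewrite in_itv/= => /andP[xi0 xid].
  by rewrite Rintegral_vallee_cos ?ger0_norm//; ring.
- move=> xi; rewrite /H/=; under eq_fun do rewrite -mulrA cosE.
  apply: L1Z; under eq_fun do rewrite mulrDl -!mulrA [cos (xi * _) * V _]mulrC
    [sin (xi * _) * V _]mulrC.
  by apply: L1D; apply: L1Z; [exact: L1M_cos|exact: L1M_sin].
- exact/L1Z/L1_norm.
- move=> t; rewrite -RintegralZr//; last exact: L1_norm.
  apply: le_Rintegral => //; first exact/L1_norm.
    by under eq_fun do rewrite mulrC; exact/L1Z/L1_norm.
  move=> xi _; rewrite /H/= !normrM ler_wpM2r// -[leRHS]mulr1 ler_wpM2l//.
  exact: cos_max.
Qed.

(* Reproduction: the symbol of [vallee d] is constant on the spectrum of [fejer d]. *)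
Lemma conv_vallee_conv_fejer M d u : 0 < d -> bounded_by M u ->
  convolution (vallee d) (convolution (fejer d) u)
  = (fun x => fejer_mass * convolution (fejer d) u x).
Proof.
move=> d0 uM; apply/funext => x.
have iF := L1_fejer d; have iV := L1_vallee d.
pose H (z : R * R) := fejer d (z.2 - z.1) * vallee d z.1 * u (x - z.2).
have [mF mV] := (L1_measurable iF, L1_measurable iV).
have mH : measurable_fun setT H.
  apply: measurable_funM; last first.
    by case: uM => mu' _; apply: (measurableT_comp mu'); exact: measurable_funB.
  apply: measurable_funM; last exact: (measurableT_comp mV).
  by apply: (measurableT_comp mF); exact: measurable_funB.
have iH1 t : L1fun (fun s => fejer d (s - t) * u (x - s)).
  under eq_fun do rewrite mulrC.
  by apply: (L1M_bounded (bounded_by_subl x uM)); exact: L1_shift.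
have F1 : bounded_by (2 + d ^+ 2) (fejer d).
  split => // y; rewrite ger0_norm ?fejer_ge0// (le_trans (fejer_le _ d0))//.
  rewrite ler_piMr ?oneDsqrV_le1//.
  by rewrite addr_ge0// sqr_ge0.
have iFV s : L1fun (fun t => fejer d (s - t) * vallee d t).
  exact: (L1_conv_integrand _ iV F1).
transitivity (\int[mu]_t \int[mu]_s H (t, s)).
  apply: eq_Rintegral => t _.
  (* Shifting [s] by [t] frees the argument of [u] from [t]; the integral over [t] is then
     [convolution (vallee d) (fejer d) s]. *)
  rewrite (_ : convolution (fejer d) u (x - t) =
      \int[mu]_s (u (x - t - (s - t)) * fejer d (s - t))); last first.
    rewrite (@Rintegral_shift _ t (fun s => u (x - t - s) * fejer d s))//.
    exact: (L1_conv_integrand _ iF uM).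
  rewrite -RintegralZr//; last first.
    exact: (L1_shift t (L1_conv_integrand (x - t) iF uM)).
  apply: eq_Rintegral => s _; rewrite /H/= (_ : x - t - (s - t) = x - s); last by ring.
  ring.
rewrite (@Rfubini _ H (fun t => (M * \int[mu]_s `|fejer d s|) * `|vallee d t|))//.
- transitivity (\int[mu]_s (fejer_mass * (u (x - s) * fejer d s))); last first.
    by rewrite RintegralZl//; exact: (L1_conv_integrand _ iF uM).
  transitivity (\int[mu]_s (u (x - s) * convolution (vallee d) (fejer d) s)).
    apply: eq_Rintegral => s _.
    by rewrite [RHS]mulrC; exact: (RintegralZr (u (x - s)) measurableT (iFV s)).
  have [mus _] := bounded_by_subl x uM.
  apply: Rintegral_ae_eq.
  + by apply: measurable_funM => //; exact: measurable_convolution.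
  + by apply: measurable_funM => //; apply: measurable_funM.
  + exists [set 0]; split; [exact: measurable_set1|exact: lebesgue_measure_set1|].
    move=> s /= Hs; apply: contrapT => s0; apply: Hs.
    by rewrite conv_vallee_fejer//; [ring|exact/eqP].
- by move=> t; rewrite /H/=; under eq_fun do rewrite mulrAC mulrC; exact: L1Z.
- move=> s; rewrite /H/=; under eq_fun do rewrite mulrC; exact/L1Z/iFV.
- exact/L1Z/L1_norm.
- move=> t; rewrite -(Rintegral_shift t (L1_norm iF)) -RintegralZl//; last first.
    exact: (L1_shift t (L1_norm iF)).
  rewrite -RintegralZr//; last exact/L1Z/(L1_shift t (L1_norm iF)).
  apply: le_Rintegral => //.
  + by apply: L1_norm; rewrite /H/=; under eq_fun do rewrite mulrAC mulrC; exact: L1Z.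
  + by under eq_fun do rewrite mulrC; exact/L1Z/L1Z/(L1_shift t (L1_norm iF)).
  + move=> s _; rewrite /H/= 2!normrM mulrC mulrA ler_wpM2r// ler_wpM2r//.
    by case: uM.
Qed.

End fejer_kernel.

(** * Local vanishing off the origin of the spectrum *)

Section spectral_vanishing.
Context {R : realType}.
Local Notation mu := (@lebesgue_measure R).
Implicit Types (f g h u v W : R -> R) (d xi : R).

Definition cosine_transform f xi : R := \int[mu]_x (f x * cos (xi * x)).
Definition sine_transform f xi : R := \int[mu]_x (f x * sin (xi * x)).

Lemma continuous_cosine_transform f : L1fun f -> continuous (cosine_transform f).
Proof.
move=> iF x.
have := @continuity_under_integral R _ _ mu (fun xi x => f x * cos (xi * x)) setT
  measurableT (x - 1) (x + 1) _ _ (fun x => `|f x|) (L1_norm iF) _ x.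
apply.
- by move=> xi _; exact: L1M_cos.
- apply: aeW => y _ z _; apply: cvgM; first exact: cvg_cst.
  apply: continuous_comp; last exact: continuous_cos.
  by apply: cvgM; [exact: cvg_id|exact: cvg_cst].
- move=> xi _; apply: aeW => y _; rewrite normrM -[leRHS]mulr1 ler_wpM2l//.
  exact: cos_max.
- by rewrite inE/= in_itv/=; apply/andP; split; lra.
Qed.

Lemma continuous_sine_transform f : L1fun f -> continuous (sine_transform f).
Proof.
move=> iF x.
have := @continuity_under_integral R _ _ mu (fun xi x => f x * sin (xi * x)) setT
  measurableT (x - 1) (x + 1) _ _ (fun x => `|f x|) (L1_norm iF) _ x.
apply.
- by move=> xi _; exact: L1M_sin.
- apply: aeW => y _ z _; apply: cvgM; first exact: cvg_cst.
  apply: continuous_comp; last exact: continuous_sin.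
  by apply: cvgM; [exact: cvg_id|exact: cvg_cst].
- move=> xi _; apply: aeW => y _; rewrite normrM -[leRHS]mulr1 ler_wpM2l//.
  exact: sin_max.
- by rewrite inE/= in_itv/=; apply/andP; split; lra.
Qed.

(* The squared distance between [1] and the Fourier transform of [f] at [xi]. *)
Definition spectral_gap f xi : R :=
  (1 - cosine_transform f xi) ^+ 2 + sine_transform f xi ^+ 2.

(** Compactness makes the gap uniform. In the application the gap is 0 at the origin, whence
    intervals with [a > 0]. *)
Lemma spectral_gap_min f (a b : R) : L1fun f -> a <= b ->
  (forall xi, a <= xi <= b -> 0 < spectral_gap f xi) ->
  exists2 m, 0 < m & forall xi, a <= xi <= b -> m <= spectral_gap f xi.
Proof.
move=> iF ab gap0.
have cgap : continuous (spectral_gap f).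
  move=> x; apply: cvgD.
    apply: (@continuous_comp _ _ _ (fun y => 1 - cosine_transform f y) (fun z => z ^+ 2)).
      apply: cvgB; [exact: cvg_cst|exact: continuous_cosine_transform].
    exact: exprn_continuous.
  apply: (@continuous_comp _ _ _ (sine_transform f) (fun z => z ^+ 2)).
    exact: continuous_sine_transform.
  exact: exprn_continuous.
have [c] := EVT_min ab (continuous_subspaceT cgap).
rewrite in_itv/= => cab cmin; exists (spectral_gap f c); first exact: gap0.
by move=> xi xiab; apply: cmin; rewrite in_itv.
Qed.

(** What the spectral argument retains of an invariant mean; positivity survives as the bound by
    [M]. Linearity is asked on bounded measurable functions only, since [phi] is arbitrary
    elsewhere. *)
Definition conv_invariant f (phi : (R -> R) -> R) : Prop :=
  [/\ forall M N u v, bounded_by M u -> bounded_by N v ->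
        phi (fun x => u x + v x) = phi u + phi v,
      forall c M u, bounded_by M u -> phi (fun x => c * u x) = c * phi u,
      forall M u, bounded_by M u -> `|phi u| <= M &
      forall M u, bounded_by M u -> phi (convolution f u) = phi u].

Lemma conv_invariantB f phi M N u v : conv_invariant f phi ->
  bounded_by M u -> bounded_by N v -> phi (fun x => u x - v x) = phi u - phi v.
Proof.
move=> [phiD phiZ _ _] uM vN; rewrite -[in RHS]mulN1r -(phiZ _ _ _ vN).
rewrite -(phiD _ _ _ _ uM (bounded_byZ (-1) vN)).
by congr phi; apply/funext => x; rewrite mulN1r.
Qed.

(** Stands for a spectrum of [W] in [[-d, d]], the set where the symbol of [vallee d] equals
    [fejer_mass]. *)
Definition vallee_fixed d W : Prop :=
  convolution (vallee d) W = (fun x => fejer_mass * W x).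

Lemma vallee_fixedD d M N u v : bounded_by M u -> bounded_by N v ->
  vallee_fixed d u -> vallee_fixed d v -> vallee_fixed d (fun x => u x + v x).
Proof.
move=> uM vN fu fv; rewrite /vallee_fixed (convD (L1_vallee d) uM vN) fu fv.
by apply/funext => x; rewrite mulrDr.
Qed.

Lemma vallee_fixedZ d c M u : bounded_by M u ->
  vallee_fixed d u -> vallee_fixed d (fun x => c * u x).
Proof.
move=> uM fu; rewrite /vallee_fixed (convZ c (L1_vallee d) uM) fu.
by apply/funext => x; rewrite mulrCA.
Qed.

(** Convolutions commute, so a narrow spectrum is kept. This lets the iteration in
    [spectral_vanishing] continue with the defects. *)
Lemma vallee_fixed_conv d M g u : L1fun g -> bounded_by M u ->
  vallee_fixed d u -> vallee_fixed d (convolution g u).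
Proof.
move=> ig uM fu; rewrite /vallee_fixed (convCA (L1_vallee d) ig uM) fu.
by rewrite (convZ _ ig uM).
Qed.

Definition multiplier_error f d : R := \int[mu]_t (modulus (vallee d) t * `|f t|).

Definition multiplier_defect g u : R -> R :=
  fun x => convolution g u x - (\int[mu]_t g t) * u x.

(** Replacing [u] by its convolution with [vallee d], divided by [fejer_mass], brings [conv_modulus]
    into play. The comparison of [g] with [f] lets one error serve for [f] times cosine and [f]
    times sine. *)
Lemma multiplier_defect_le f g d M u : L1fun f -> L1fun g ->
  (forall x, `|g x| <= `|f x|) -> bounded_by M u -> vallee_fixed d u ->
  bounded_by (M * multiplier_error f d / fejer_mass) (multiplier_defect g u).
Proof.
move=> iF ig gf uM fu; have mass0 := @fejer_mass_gt0 R.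
have iV := L1_vallee d.
split.
  apply: measurable_funB; first by case: (conv_bounded ig uM).
  by apply: measurable_funM => //; case: uM.
move=> x; rewrite ler_pdivlMr// -{1}(gtr0_norm mass0) -normrM mulrC.
have := conv_modulus x ig iV uM; rewrite fu (convZ _ ig uM) mulrCA -mulrBr.
move=> /le_trans; apply; rewrite ler_wpM2l ?(bounded_by_ge0 uM)//.
apply: le_Rintegral => //.
- exact: (L1M_bounded (bounded_modulus iV) (L1_norm ig)).
- exact: (L1M_bounded (bounded_modulus iV) (L1_norm iF)).
- by move=> t _; rewrite ler_wpM2l// modulus_ge0.
Qed.

Lemma vallee_fixed_defect M g d u : L1fun g -> bounded_by M u ->
  vallee_fixed d u -> vallee_fixed d (multiplier_defect g u).
Proof.
move=> ig uM fu; rewrite /multiplier_defect; under eq_fun do rewrite -mulNr.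
apply: (vallee_fixedD (conv_bounded ig uM) (bounded_byZ _ uM)).
  exact: (vallee_fixed_conv ig uM).
exact: (vallee_fixedZ _ uM).
Qed.

(** With [W = W1 + i W2], this is the real part of the rule that convolving [f] with [e^(i xi x) W]
    gives [e^(i xi x)] times the convolution of [e^(- i xi t) f] with [W]. *)
Lemma conv_modulated f xi W1 W2 M x : L1fun f -> bounded_by M W1 -> bounded_by M W2 ->
  convolution f (fun x => cos (xi * x) * W1 x - sin (xi * x) * W2 x) x =
  cos (xi * x) * (convolution (fun t => f t * cos (xi * t)) W1 x +
                  convolution (fun t => f t * sin (xi * t)) W2 x) -
  sin (xi * x) * (convolution (fun t => f t * cos (xi * t)) W2 x -
                  convolution (fun t => f t * sin (xi * t)) W1 x).
Proof.
move=> iF W1M W2M.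
have [ic is_] := (L1M_cos xi iF, L1M_sin xi iF).
have i11 := L1_conv_integrand x ic W1M; have i21 := L1_conv_integrand x is_ W1M.
have i12 := L1_conv_integrand x ic W2M; have i22 := L1_conv_integrand x is_ W2M.
rewrite /convolution -RintegralD// -[X in _ = _ - _ * X]RintegralB//.
rewrite -!RintegralZl//; [|exact: L1B|exact: L1D].
rewrite -RintegralB//; [|by apply: L1Z; exact: L1D|by apply: L1Z; exact: L1B].
by apply: eq_Rintegral => t _; rewrite mulrBr cosB sinB; ring.
Qed.

Lemma norm_le_geometric_eq0 (c x : R) : (forall n, `|x| <= c / 2 ^+ n) -> x = 0.
Proof.
move=> xc; apply/eqP; rewrite -normr_le0.
have h : `|2^-1 : R| < 1 by rewrite gtr0_norm// invf_lt1// ltr1n.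
apply: (cvgr_to_ge (cvg_geometric c h)).
by apply: nearW => n; rewrite /geometric/= exprVn.
Qed.

(** One round multiplies the bound by at most [2 * multiplier_error f d / fejer_mass] for passing to
    the defects, times [1 + 2 * F] over the gap for solving the linear system, where [F] is the L1
    norm of [f]. The smallness hypothesis makes this factor at most one half. *)
Lemma spectral_vanishing f phi d xi m M W : L1fun f -> conv_invariant f phi ->
  0 < m -> m <= spectral_gap f xi ->
  (1 + 2 * \int[mu]_x `|f x|) * (2 * multiplier_error f d / fejer_mass) <= m / 2 ->
  bounded_by M W -> vallee_fixed d W ->
  phi (fun x => cos (xi * x) * W x) = 0 /\ phi (fun x => sin (xi * x) * W x) = 0.
Proof.
move=> iF phiP m0 gapm small WM fW; have [phiD phiZ phi_le phi_inv] := phiP.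
have mass0 := @fejer_mass_gt0 R.
have [bc bs] := (bounded_by_cos xi, bounded_by_sin xi).
have [ic is_] := (L1M_cos xi iF, L1M_sin xi iF).
set al := cosine_transform f xi in gapm *; set be := sine_transform f xi in gapm *.
set F := \int[mu]_x `|f x| in small.
set E := multiplier_error f d in small.
have F0 : 0 <= F by apply: Rintegral_ge0.
have alF : `|al| <= F.
  by have := Rintegral_bounded bc iF; rewrite mul1r; under eq_Rintegral do rewrite mulrC.
have beF : `|be| <= F.
  by have := Rintegral_bounded bs iF; rewrite mul1r; under eq_Rintegral do rewrite mulrC.
(* [P1] and [P2] are the real and imaginary parts of [phi (e^(i xi x) W)] for
   [W = W1 + i W2].  Invariance gives [(1 - c) phi (e^(i xi x) W) = phi (e^(i xi x) V)]
   with [c] the Fourier transform of [f] at [xi] and [V] small and again fixed. *)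
pose P1 W1 W2 := phi (fun x => cos (xi * x) * W1 x - sin (xi * x) * W2 x).
pose P2 W1 W2 := phi (fun x => cos (xi * x) * W2 x + sin (xi * x) * W1 x).
have main n : forall K W1 W2, bounded_by K W1 -> bounded_by K W2 ->
    vallee_fixed d W1 -> vallee_fixed d W2 ->
    `|P1 W1 W2| <= 2 * K / 2 ^+ n /\ `|P2 W1 W2| <= 2 * K / 2 ^+ n.
  elim: n => [|n IH] K W1 W2 W1K W2K fW1 fW2.
    rewrite expr0 divr1 mulr_natl mulr2n -{1 3}[K]mul1r -{1 2}[K in _ + K]mul1r.
    split; apply: phi_le.
      exact: (bounded_byB (bounded_byM bc W1K) (bounded_byM bs W2K)).
    exact: (bounded_byD (bounded_byM bc W2K) (bounded_byM bs W1K)).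
  set fc := fun t => f t * cos (xi * t) in ic.
  set fs := fun t => f t * sin (xi * t) in is_.
  have fcf x : `|fc x| <= `|f x| by rewrite normrM -[leRHS]mulr1 ler_wpM2l// cos_max.
  have fsf x : `|fs x| <= `|f x| by rewrite normrM -[leRHS]mulr1 ler_wpM2l// sin_max.
  set K' := K * E / fejer_mass.
  have c1 : bounded_by K' (multiplier_defect fc W1) by apply: multiplier_defect_le.
  have c2 : bounded_by K' (multiplier_defect fc W2) by apply: multiplier_defect_le.
  have s1 : bounded_by K' (multiplier_defect fs W1) by apply: multiplier_defect_le.
  have s2 : bounded_by K' (multiplier_defect fs W2) by apply: multiplier_defect_le.
  pose V1 x := multiplier_defect fc W1 x + multiplier_defect fs W2 x.
  pose V2 x := multiplier_defect fc W2 x - multiplier_defect fs W1 x.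
  have V1K : bounded_by (K' + K') V1 by exact: bounded_byD.
  have V2K : bounded_by (K' + K') V2 by exact: bounded_byB.
  have fV1 : vallee_fixed d V1.
    apply: (vallee_fixedD c1 s2); first exact: (vallee_fixed_defect ic W1K).
    exact: (vallee_fixed_defect is_ W2K).
  have fV2 : vallee_fixed d V2.
    rewrite /V2; under eq_fun do rewrite -mulN1r.
    apply: (vallee_fixedD c2 (bounded_byZ (-1) s1)); first exact: (vallee_fixed_defect ic W2K).
    by apply: (vallee_fixedZ _ s1); exact: (vallee_fixed_defect is_ W1K).
  have [P1V P2V] := IH _ _ _ V1K V2K fV1 fV2.
  pose U W1 W2 x := cos (xi * x) * W1 x - sin (xi * x) * W2 x.
  pose V W1 W2 x := cos (xi * x) * W2 x + sin (xi * x) * W1 x.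
  have UK L Z1 Z2 : bounded_by L Z1 -> bounded_by L Z2 -> bounded_by (1 * L + 1 * L) (U Z1 Z2).
    by move=> Z1L Z2L; exact: (bounded_byB (bounded_byM bc Z1L) (bounded_byM bs Z2L)).
  have VK L Z1 Z2 : bounded_by L Z1 -> bounded_by L Z2 -> bounded_by (1 * L + 1 * L) (V Z1 Z2).
    by move=> Z1L Z2L; exact: (bounded_byD (bounded_byM bc Z2L) (bounded_byM bs Z1L)).
  have lin3 a b u1 u2 u3 K1 K2 K3 : bounded_by K1 u1 -> bounded_by K2 u2 -> bounded_by K3 u3 ->
      phi (fun x => a * u1 x + (b * u2 x + u3 x)) = a * phi u1 + (b * phi u2 + phi u3).
    move=> k1 k2 k3.
    rewrite (phiD _ _ _ _ (bounded_byZ a k1) (bounded_byD (bounded_byZ b k2) k3)).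
    by rewrite (phiD _ _ _ _ (bounded_byZ b k2) k3) (phiZ _ _ _ k1) (phiZ _ _ _ k2).
  have eqU : P1 W1 W2 = al * P1 W1 W2 + (be * P2 W1 W2 + P1 V1 V2).
    rewrite -(lin3 _ _ _ _ _ _ _ _ (UK _ _ _ W1K W2K) (VK _ _ _ W1K W2K) (UK _ _ _ V1K V2K)).
    rewrite /P1 -[LHS](phi_inv _ _ (UK _ _ _ W1K W2K)); congr phi; apply/funext => x.
    rewrite (conv_modulated _ _ iF W1K W2K) /U /V /V1 /V2 /multiplier_defect -/fc -/fs.
    by rewrite -/(cosine_transform f xi) -/(sine_transform f xi) -/al -/be; ring.
  have eqV : P2 W1 W2 = al * P2 W1 W2 + (- be * P1 W1 W2 + P2 V1 V2).
    rewrite -(lin3 _ _ _ _ _ _ _ _ (VK _ _ _ W1K W2K) (UK _ _ _ W1K W2K) (VK _ _ _ V1K V2K)).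
    rewrite /P2 -[LHS](phi_inv _ _ (VK _ _ _ W1K W2K)); congr phi; apply/funext => x.
    (* The imaginary part of [e^(i xi x) W] is the real part of [e^(i xi x) (- i W)], and
       [- i W = W2 - i W1]; so [conv_modulated] is applied to the pair [W2], [- W1]. *)
    have NW1K : bounded_by K (fun x => -1 * W1 x).
      by have := bounded_byZ (-1) W1K; rewrite normrN1 mul1r.
    transitivity (convolution f
        (fun x => cos (xi * x) * W2 x - sin (xi * x) * (-1 * W1 x)) x).
      by congr convolution; apply/funext => y; rewrite /V; ring.
    rewrite (conv_modulated _ _ iF W2K NW1K) (convZ _ ic W1K) (convZ _ is_ W1K).
    rewrite /U /V /V1 /V2 /multiplier_defect -/fc -/fs.
    by rewrite -/(cosine_transform f xi) -/(sine_transform f xi) -/al -/be; ring.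
  set p1 := P1 W1 W2 in eqU eqV *; set p2 := P2 W1 W2 in eqU eqV *.
  set q1 := P1 V1 V2 in P1V eqU; set q2 := P2 V1 V2 in P2V eqV.
  (* From [q = (1 - c) p], multiplication by the conjugate of [1 - c] isolates [p], with the gap as
     the squared modulus of [1 - c]. *)
  have e1 : spectral_gap f xi * p1 = (1 - al) * q1 + be * q2.
    rewrite /spectral_gap -/al -/be.
    have -> : q1 = (1 - al) * p1 - be * p2 by move: eqU; lra.
    have -> : q2 = (1 - al) * p2 + be * p1 by move: eqV; lra.
    ring.
  have e2 : spectral_gap f xi * p2 = (1 - al) * q2 - be * q1.
    rewrite /spectral_gap -/al -/be.
    have -> : q1 = (1 - al) * p1 - be * p2 by move: eqU; lra.
    have -> : q2 = (1 - al) * p2 + be * p1 by move: eqV; lra.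
    ring.
  set B := 2 * (K' + K') / 2 ^+ n in P1V P2V.
  have al1 : `|1 - al| <= 1 + F by rewrite (le_trans (ler_normB _ _))// normr1 lerD2l.
  have bound r s p : `|r| <= B -> `|s| <= B ->
      spectral_gap f xi * p = (1 - al) * r + be * s -> `|p| <= 2 * K / 2 ^+ n.+1.
    move=> rB sB ep; rewrite -(ler_pM2l m0).
    apply: (@le_trans _ _ ((1 + 2 * F) * B)).
      apply: (@le_trans _ _ `|spectral_gap f xi * p|).
        by rewrite normrM ler_wpM2r// (le_trans gapm)// ler_norm.
      rewrite ep (le_trans (ler_normD _ _))// !normrM.
      rewrite (_ : 1 + 2 * F = (1 + F) + F); last by ring.
      by rewrite mulrDl lerD// ler_pM.
    have K0 := bounded_by_ge0 W1K.
    have c0 : 0 <= 2 * K / 2 ^+ n by rewrite divr_ge0 ?mulr_ge0// exprn_ge0.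
    have := ler_wpM2l c0 small; rewrite /B /K'.
    rewrite (_ : 2 * K / 2 ^+ n * (m / 2) = m * (2 * K / 2 ^+ n.+1)); last first.
      by rewrite exprS; field; rewrite expf_neq0.
    apply: le_trans; rewrite le_eqVlt; apply/orP; left; apply/eqP.
    by field; rewrite gt_eqF//= expf_neq0.
  split; first exact: (bound q1 q2).
  by apply: (bound q2 (- q1)); rewrite ?normrN// mulrN.
have M0 := bounded_by_ge0 WM.
(* With imaginary part 0, [P1] and [P2] are exactly the two values to be shown zero. *)
have zM : bounded_by M (cst 0) by split=> // x; rewrite normr0.
have fz : vallee_fixed d (cst 0).
  rewrite /vallee_fixed; apply/funext => x; rewrite /convolution.
  by under eq_Rintegral do rewrite mul0r; rewrite Rintegral_cst// mul0r mulr0.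
split; apply: (@norm_le_geometric_eq0 (2 * M)) => n.
  have [+ _] := main n _ _ _ WM zM fW fz.
  rewrite /P1; under [X in phi X]eq_fun do rewrite mulr0 subr0.
  by [].
have [_ +] := main n _ _ _ WM zM fW fz.
rewrite /P2; under [X in phi X]eq_fun do rewrite mulr0 add0r.
by [].
Qed.

End spectral_vanishing.

(** * Functionals invariant under convolution *)

Section tauberian.
Context {R : realType}.
Local Notation mu := (@lebesgue_measure R).
Implicit Types (f g h u v W : R -> R) (d xi : R).

(** Modulating the kernel amounts to modulating [u] before and after convolution with [fejer d].
    Each summand is a trigonometric factor times a function of narrow spectrum, the form that
    [spectral_vanishing] treats. *)
Lemma conv_cos_fejer M d xi u x : bounded_by M u ->
  convolution (fun t => fejer d t * cos (xi * t)) u x =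
  cos (xi * x) * convolution (fejer d) (fun t => cos (xi * t) * u t) x +
  sin (xi * x) * convolution (fejer d) (fun t => sin (xi * t) * u t) x.
Proof.
move=> uM; have iF := L1_fejer d.
have i1 := L1_conv_integrand x iF (bounded_byM (bounded_by_cos xi) uM).
have i2 := L1_conv_integrand x iF (bounded_byM (bounded_by_sin xi) uM).
rewrite /convolution -!RintegralZl// -RintegralD//; [|exact: L1Z|exact: L1Z].
apply: eq_Rintegral => t _.
have -> : cos (xi * t) = cos (xi * x) * cos (xi * (x - t)) + sin (xi * x) * sin (xi * (x - t)).
  by rewrite -cosB; congr cos; ring.
ring.
Qed.

Lemma phi_conv_cos_fejer f phi d xi m M u : L1fun f -> conv_invariant f phi ->
  0 < d -> 0 < m -> m <= spectral_gap f xi ->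
  (1 + 2 * \int[mu]_x `|f x|) * (2 * multiplier_error f d / fejer_mass) <= m / 2 ->
  bounded_by M u -> phi (convolution (fun t => fejer d t * cos (xi * t)) u) = 0.
Proof.
move=> iF phiP d0 m0 gapm small uM; have iK := L1_fejer d.
have ucM := bounded_byM (bounded_by_cos xi) uM; have usM := bounded_byM (bounded_by_sin xi) uM.
have cM := conv_bounded iK ucM; have sM := conv_bounded iK usM.
have [c0 _] := spectral_vanishing iF phiP m0 gapm small cM (conv_vallee_conv_fejer d0 ucM).
have [_ s0] := spectral_vanishing iF phiP m0 gapm small sM (conv_vallee_conv_fejer d0 usM).
have -> : convolution (fun t => fejer d t * cos (xi * t)) u = fun x =>
  cos (xi * x) * convolution (fejer d) (fun t => cos (xi * t) * u t) x +
  sin (xi * x) * convolution (fejer d) (fun t => sin (xi * t) * u t) x.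
  by apply/funext => x; exact: (conv_cos_fejer d xi x uM).
case: phiP => phiD _ _ _.
rewrite (phiD _ _ _ _ (bounded_byM (bounded_by_cos xi) cM) (bounded_byM (bounded_by_sin xi) sM)).
by rewrite c0 s0 addr0.
Qed.

Lemma phi_fejer_second_difference f phi M d s u : conv_invariant f phi -> bounded_by M u ->
  phi (convolution (fejer (s + d)) u) + phi (convolution (fejer (s - d)) u)
  - 2 * phi (convolution (fejer s) u)
  = 2 * phi (convolution (fun t => fejer d t * cos (s * t)) u).
Proof.
move=> phiP uM; have iK e := L1_fejer (e : R).
have cM e := conv_bounded (iK e) uM.
have ic : L1fun (fun t => fejer d t * cos (s * t)) by exact: L1M_cos.
have [phiD phiZ _ _] := phiP.
rewrite -(phiD _ _ _ _ (cM _) (cM _)) -(phiZ _ _ _ (cM _)) -(phiZ _ _ _ (conv_bounded ic uM)).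
rewrite -(conv_invariantB phiP (bounded_byD (cM _) (cM _)) (bounded_byZ 2 (cM _))).
congr phi; rewrite -(convZl 2 ic uM); apply/funext => x.
have -> : (fun t => 2 * (fejer d t * cos (s * t))) =
    (fun t => (fejer (s + d) t + fejer (s - d) t) - 2 * fejer s t).
  (* [fejerM_cos] produces [fejer (d - s)], which evenness in the parameter turns into
     [fejer (s - d)]. *)
  by apply/funext => t; rewrite fejerM_cos -(fejerN (d - s)) opprB [d + s]addrC; field.
have iD : L1fun (fun t => fejer (s + d) t + fejer (s - d) t) by exact: L1D.
apply/esym; apply: (etrans (congr1 (@^~ x) (convBl iD (L1Z 2 (iK s)) uM))).
rewrite (convZl 2 (iK s) uM); congr (_ - _); rewrite {1}/convolution.
under eq_Rintegral do rewrite mulrDr.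
by rewrite RintegralD//; exact: (L1_conv_integrand _ (iK _) uM).
Qed.

(** A narrower spectrum becomes a smaller translation of one fixed kernel, so the error tends to 0
    with [d] by [L1_modulus_cvg0]. *)
Lemma multiplier_errorE f d : 0 < d ->
  multiplier_error f d = \int[mu]_t (modulus (vallee 1) (d * t) * `|f t|).
Proof.
move=> d0; apply: eq_Rintegral => t _; congr (_ * _).
rewrite -(modulus_affine _ d0 (L1_vallee 1)).
by apply: eq_Rintegral => s _; rewrite !(@vallee_scale _ d)// gt_eqF.
Qed.

Lemma phi_conv_vallee f phi M b u : conv_invariant f phi -> bounded_by M u ->
  phi (convolution (vallee b) u) =
  b^-1 * (phi (convolution (fejer (2 * b)) u) - phi (convolution (fejer b) u)).
Proof.
move=> phiP uM; have iK e := L1_fejer (e : R).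
have cM e := conv_bounded (iK e) uM.
rewrite -(conv_invariantB phiP (cM _) (cM _)).
case: phiP => _ phiZ _ _; rewrite -(phiZ _ _ _ (bounded_byB (cM _) (cM _))).
congr phi; have -> : vallee b = (fun t => b^-1 * (fejer (2 * b) t - fejer b t)).
  by apply/funext => t; rewrite /vallee mulrC.
apply: (etrans (convZl b^-1 (L1B (iK (2 * b)) (iK b)) uM)).
by rewrite (convBl (iK (2 * b)) (iK b) uM).
Qed.

(** The recurrence reaches back two steps, hence strong induction with two base cases. Centres start
    at [K + 1], so that [p K] is the leftmost value involved. *)
Lemma affine_of_second_difference (p : nat -> R) (K L : nat) :
  (forall j, (K < j <= L)%N -> p j.+1 + p j.-1 - 2 * p j = 0) ->
  forall i, (K + i <= L.+1)%N -> p (K + i)%N = p K + i%:R * (p K.+1 - p K).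
Proof.
move=> pj i; have [n] := ubnP i; elim: n i => // n IH [|[|i]] /=.
- by rewrite addn0 mul0r addr0.
- by rewrite addn1 mul1r addrC subrK.
- rewrite !ltnS => lin; rewrite !addnS ltnS => KiL.
  have := pj (K + i).+1; rewrite KiL ltnS leq_addr => /(_ isT) /=.
  have /= := IH i (ltnW lin) (leq_trans (leq_addr 2 _) _).
  have := IH i.+1 lin; rewrite addnS => -> //; last by rewrite ltnW.
  move=> -> //; last by rewrite addn2 ltnS.
  by rewrite -!natr1; lra.
Qed.

Lemma phi_conv_vallee_eq f phi M a n u : L1fun f -> conv_invariant f phi ->
  (forall xi, xi != 0 -> 0 < spectral_gap f xi) -> 0 < a -> bounded_by M u ->
  phi (convolution (vallee (n.+1%:R * a)) u) = phi (convolution (vallee a) u).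
Proof.
move=> iF phiP gap0 a0 uM; have mass0 := @fejer_mass_gt0 R.
(* The Fejer parameters in the two kernels are [a], [2 * a], [n.+1 * a] and [2 * n.+1 * a]; all lie
   in this interval. *)
have ab : a <= 2 * n.+1%:R * a.
  by rewrite -{1}[a]mul1r ler_pM2r// -natrM ler1n muln_gt0.
have [|m m0 gapm] := spectral_gap_min iF ab.
  by move=> xi /andP[axi _]; rewrite gap0// gt_eqF// (lt_le_trans a0).
set F := \int[mu]_x `|f x|.
have F0 : 0 <= F by exact: Rintegral_ge0.
(* The gap [m] is fixed before the grid, which can now be refined until the error is small against
   [m]. *)
have [k small] : exists k : nat,
    (1 + 2 * F) * (2 * multiplier_error f (a / k.+1%:R) / fejer_mass) <= m / 2.
  have s0 : (a / k.+1%:R) @[k --> \oo] --> 0.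
    by rewrite -[X in _ --> X](mulr0 a); apply: cvgMr; exact: cvg_harmonic.
  have e0 : 0 < m / 2 * fejer_mass / (2 * (1 + 2 * F)).
    by rewrite divr_gt0 ?mulr_gt0 ?divr_gt0// ltr_wpDr ?mulr_ge0.
  have /cvgrPdist_lt/(_ _ e0)[k _ /(_ k (leqnn k))] := L1_modulus_cvg0 (L1_vallee 1) iF s0.
  rewrite sub0r normrN => /(le_lt_trans (ler_norm _)).
  rewrite -multiplier_errorE ?divr_gt0// => /ltW H; exists k; move: H.
  rewrite ler_pdivlMr ?mulr_gt0 ?ltr_wpDr ?mulr_ge0// => H.
  rewrite -(ler_pM2r mass0); apply: le_trans H; rewrite le_eqVlt; apply/orP; left; apply/eqP.
  by field; rewrite gt_eqF.
(* The step divides [a], so that all four parameters are grid points. *)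
set K := k.+1; set d := a / K%:R; have d0 : 0 < d by rewrite divr_gt0// ltr0n.
have aK : a = K%:R * d by rewrite /d mulrC divfK// gt_eqF// ltr0n.
pose p j := phi (convolution (fejer (j%:R * d)) u).
have pj j : (K < j <= 2 * n.+1 * K)%N -> p j.+1 + p j.-1 - 2 * p j = 0.
  move=> /andP[Kj jL]; have j0 : (0 < j)%N by rewrite (leq_ltn_trans _ Kj).
  have := @phi_fejer_second_difference f phi M d (j%:R * d) u phiP uM.
  rewrite (@phi_conv_cos_fejer f phi d (j%:R * d) m M u iF phiP d0 m0 _ small uM); last first.
    apply: gapm; rewrite {1 2}aK mulrA !ler_pM2r// -!natrM !ler_nat.
    by rewrite (ltnW Kj) jL.
  rewrite mulr0 (_ : j%:R * d + d = j.+1%:R * d); last by rewrite -natr1; ring.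
  by rewrite (_ : j%:R * d - d = j.-1%:R * d)// -{1}(prednK j0) -natr1; ring.
have paff := affine_of_second_difference pj.
have pE i : (K <= i <= 2 * n.+1 * K)%N -> p i = p K + (i%:R - K%:R) * (p K.+1 - p K).
  move=> /andP[Ki iL]; rewrite -natrB// -paff ?subnKC//.
  exact: leqW.
rewrite !(phi_conv_vallee _ phiP uM).
have fejerK i c : c = i%:R * d -> phi (convolution (fejer c) u) = p i by move=> ->.
rewrite (fejerK (2 * n.+1 * K)%N); last by rewrite aK !natrM; ring.
rewrite (fejerK (n.+1 * K)%N); last by rewrite aK !natrM; ring.
rewrite (fejerK (2 * K)%N); last by rewrite aK !natrM; ring.
rewrite (fejerK K)// (pE (2 * n.+1 * K)%N) ?(pE (n.+1 * K)%N) ?(pE (2 * K)%N).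
- rewrite !natrM aK; field.
  by rewrite !gt_eqF ?ltr0n//= ltr0n.
- by rewrite leq_pmull//= -mulnA leq_mul2l leq_pmull.
- by rewrite leq_pmull//= -mulnA leq_pmull.
- by rewrite leq_pmull ?muln_gt0//= leqnn.
Qed.

(** At a low cutoff, [h] nearly annihilates the slowly varying [vallee] mean of [u], because its
    integral is 0. At a high cutoff, [vallee] acts on [convolution h u] nearly as [fejer_mass] times
    the identity. *)
Lemma phi_conv_mean0 f phi h M u : L1fun f -> conv_invariant f phi ->
  (forall xi, xi != 0 -> 0 < spectral_gap f xi) -> L1fun h -> \int[mu]_x h x = 0 ->
  bounded_by M u -> phi (convolution h u) = 0.
Proof.
move=> iF phiP gap0 ih h0 uM; have mass0 := @fejer_mass_gt0 R.
have wM := conv_bounded ih uM.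
pose a k : R := k.+1%:R^-1.
have a_gt0 k : 0 < a k by rewrite invr_gt0.
pose e1 k := \int[mu]_t (modulus (vallee 1) (a k * t) * `|h t|).
pose e2 k := \int[mu]_t (modulus h (a k * t) * `|vallee 1 t|).
have e1_0 : e1 k @[k --> \oo] --> 0.
  by apply: L1_modulus_cvg0 => //; [exact: L1_vallee|exact: cvg_harmonic].
have e2_0 : e2 k @[k --> \oo] --> 0.
  by apply: L1_modulus_cvg0 => //; [exact: L1_vallee|exact: cvg_harmonic].
have [phiD phiZ phi_le phi_inv] := phiP.
have low k : `|phi (convolution (vallee (a k)) (convolution h u))| <= M * e1 k.
  apply: phi_le; split.
    by apply: measurable_convolution; [exact: (L1_measurable (L1_vallee _))|case: wM].
  move=> x; rewrite (convCA (L1_vallee _) ih uM).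
  have := conv_modulus x ih (L1_vallee (a k)) uM; rewrite h0 mul0r subr0.
  by rewrite -/(multiplier_error h (a k)) multiplier_errorE.
have high k : `|phi (convolution (vallee (k.+1%:R)) (convolution h u)) -
    fejer_mass * phi (convolution h u)| <= M * e2 k.
  have iV := @L1_vallee R k.+1%:R.
  have VM := conv_bounded iV wM.
  rewrite -(phiZ _ _ _ wM) -(conv_invariantB phiP VM (bounded_byZ _ wM)).
  apply: phi_le; split.
    by apply: measurable_funB; [case: VM|apply: measurable_funM => //; case: wM].
  move=> x; have := conv_modulus x iV ih uM; rewrite Rintegral_vallee ?ltr0n//.
  move=> /le_trans; apply; rewrite ler_wpM2l ?(bounded_by_ge0 uM)//.
  have b0 : k.+1%:R != 0 :> R by rewrite pnatr_eq0.
  have iG : L1fun (fun s => modulus h (a k * s) * `|vallee 1 s|).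
    apply: (L1M_bounded _ (L1_norm (L1_vallee 1))).
    have := bounded_by_affine (a k) 0 (bounded_modulus ih).
    by congr bounded_by; apply/funext => s; rewrite addr0.
  (* The substitution [s = k.+1 * t] moves the dilation from [vallee] into the argument of
     [modulus]. *)
  have := Rintegral_affine 0 b0 iG; rewrite gtr0_norm ?ltr0n//.
  move=> /(congr1 (fun y => k.+1%:R * y)); rewrite mulVKf// /e2 => <-.
  rewrite -RintegralZl//; last exact: (integrable_affine 0 b0 iG).
  rewrite le_eqVlt; apply/orP; left; apply/eqP; apply: eq_Rintegral => t _.
  rewrite addr0 /a mulKf// (vallee_scale _ b0) normrM gtr0_norm ?ltr0n//.
  by rewrite mulrCA.
have key k : `|fejer_mass * phi (convolution h u)| <= M * (e1 k + e2 k).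
  (* The cutoffs [1 / k.+1] and [k.+1] have ratio [k.+1 * k.+1]; the predecessor offsets the
     successor in [phi_conv_vallee_eq]. *)
  have := @phi_conv_vallee_eq f phi _ (a k) (k.+1 * k.+1).-1 _ iF phiP gap0 (a_gt0 k) wM.
  rewrite prednK// (_ : (k.+1 * k.+1)%N%:R * a k = k.+1%:R); last first.
    by rewrite /a natrM mulfK// pnatr_eq0.
  move=> E; have := low k; have := high k; rewrite -E mulrDr => H1 H2.
  rewrite -[_ * _](subrK (phi (convolution (vallee k.+1%:R) (convolution h u)))).
  rewrite (le_trans (ler_normD _ _))// addrC lerD// distrC//.
have : `|fejer_mass * phi (convolution h u)| <= 0.
  have H : M * (e1 k + e2 k) @[k --> \oo] --> M * (0 + 0).
    by apply: cvgMr; apply: cvgD.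
  rewrite addr0 mulr0 in H.
  by apply: (cvgr_to_ge H); exact: nearW.
by rewrite normr_le0 mulf_eq0 gt_eqF//= => /eqP.
Qed.

End tauberian.

(** * Running averages and their upper limits *)

Section running_average.
Context {R : realType}.
Local Notation mu := (@lebesgue_measure R).
Implicit Types (f g h u v : R -> R) (th x : R).

Definition average th u x : R := th^-1 * \int[mu]_(t in `[x, x + th]) u t.

(** The interval lies left of 0 because convolution reflects it: the window of [average] extends to
    the right of [x]. *)
Definition box th x : R := th^-1 * \1_(`[- th, 0]) x.

Lemma L1_box th : L1fun (box th).
Proof. by apply: L1Z; exact: (@integrable_indic_itv R (- th) 0 true false). Qed.

Lemma Rintegral_box th : 0 < th -> \int[mu]_x box th x = 1.
Proof.
move=> th0; rewrite RintegralZl//; last exact: (@integrable_indic_itv R (- th) 0 true false).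
rewrite /Rintegral integral_indic ?setIT; [|exact: measurableT|exact: measurable_itv].
rewrite -[X in fine X]/(mu [set` `[- th, 0]]) lebesgue_measure_itv/= lte_fin oppr_lt0 th0/=.
by rewrite sub0r opprK mulVf// gt_eqF.
Qed.

Lemma box_scale th x : 0 < th -> box th x = th^-1 * box 1 (th^-1 * x).
Proof.
move=> th0; rewrite /box invr1 mul1r; congr (_ * _); rewrite !indicE; congr ((nat_of_bool _)%:R).
by apply/idP/idP => /set_mem/=; rewrite in_itv/= => /andP[x1 x2]; apply/mem_set => /=;
  rewrite in_itv/=; move: x1 x2; rewrite mulrC ler_pdivlMr// ler_pdivrMr// mulN1r mul0r => -> ->.
Qed.

Lemma L1_itv M u (a b : R) : bounded_by M u -> L1fun (fun t => u t * \1_(`[a, b]) t).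
Proof. by move=> uM; apply: (L1M_bounded uM); exact: (@integrable_indic_itv R a b true false). Qed.

Lemma Rintegral_itv_indic u (a b : R) :
  \int[mu]_(t in `[a, b]) u t = \int[mu]_t (u t * \1_(`[a, b]) t).
Proof.
rewrite Rintegral_mkcond; apply: eq_Rintegral => t _.
by rewrite patchE indicE; case: (_ \in _); rewrite ?mulr1 ?mulr0.
Qed.

Lemma conv_box M th u : bounded_by M u -> convolution (box th) u = average th u.
Proof.
move=> uM; apply/funext => x; rewrite (conv_reflect x (L1_box th) uM) /average.
rewrite Rintegral_itv_indic -RintegralZl//; last exact: (L1_itv _ _ uM).
apply: eq_Rintegral => t _; rewrite /box !indicE.
have -> : (x - t \in `[- th, 0]%classic) = (t \in `[x, x + th]%classic).
  by apply/idP/idP => /set_mem/=; rewrite in_itv/= => /andP[x1 x2]; apply/mem_set => /=;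
    rewrite in_itv/=; apply/andP; split; lra.
by rewrite mulrCA.
Qed.

Lemma bounded_average M th u : 0 < th -> bounded_by M u -> bounded_by M (average th u).
Proof.
move=> th0 uM; rewrite -(conv_box _ uM).
have := conv_bounded (L1_box th) uM.
suff -> : \int[mu]_t `|box th t| = 1 by rewrite mulr1.
rewrite -(Rintegral_box th0); apply: eq_Rintegral => t _.
by rewrite ger0_norm// mulr_ge0 ?invr_ge0 ?(ltW th0)// indicE ler0n.
Qed.

Definition average_error g th : R :=
  \int[mu]_t (modulus (box 1) (th^-1 * t) * `|g t|).

(** Averaging is a convolution and commutes with [g]. Then [box th] plays the role of [K] in
    [conv_modulus], and its modulus is that of [box 1] at a translation shortened by [th]. *)
Lemma average_conv_le M g u th x : 0 < th -> L1fun g -> \int[mu]_t g t = 1 ->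
  bounded_by M u ->
  `|average th (convolution g u) x - average th u x| <= M * average_error g th.
Proof.
move=> th0 ig g1 uM; have iB := L1_box th.
rewrite -(conv_box _ (conv_bounded ig uM)) -(conv_box _ uM) (convCA iB ig uM).
suff -> : average_error g th = \int[mu]_t (modulus (box th) t * `|g t|).
  by have := conv_modulus x ig iB uM; rewrite g1 mul1r.
apply: eq_Rintegral => t _; rewrite -(modulus_affine t _ (L1_box 1)) ?invr_gt0//.
by have -> : box th = (fun y => th^-1 * box 1 (th^-1 * y)) by apply/funext => s; exact: box_scale.
Qed.

Lemma average_error_cvg0 g : L1fun g -> average_error g th @[th --> +oo] --> 0.
Proof.
(* The limit is reduced to sequences, along which [L1_modulus_cvg0] is stated. *)
move=> ig; apply/cvg_pinftyP => a ay.
apply: (@L1_modulus_cvg0 _ (box 1) g (fun n => (a n)^-1)) => //; first exact: L1_box.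
apply/gtr0_cvgV0; last exact: ay.
by have /cvgryPgt/(_ 0) := ay.
Qed.

(** A window that starts beyond [X] stays beyond [X]. *)
Lemma average_le M th u c X : 0 < th -> bounded_by M u ->
  (forall x, X < x -> u x <= c) -> forall x, X < x -> average th u x <= c.
Proof.
move=> th0 uM uc x Xx; rewrite /average mulrC ler_pdivrMr// !Rintegral_itv_indic.
have -> : c * th = \int[mu]_t (c * \1_(`[x, x + th]) t).
  rewrite RintegralZl//; last exact: (@integrable_indic_itv R x (x + th) true false).
  rewrite /Rintegral integral_indic ?setIT; [|exact: measurableT|exact: measurable_itv].
  rewrite -[X in fine X]/(mu [set` `[x, x + th]]) lebesgue_measure_itv/= lte_fin ltrDl th0/=.
  by rewrite addrAC subrr add0r.
apply: le_Rintegral => //; [exact: (L1_itv _ _ uM)|exact: (L1_itv _ _ (bounded_by_cst c))|].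
move=> t _; rewrite indicE; case: (boolP (_ \in _)) => [|_]; last by rewrite !mulr0.
by move=> /set_mem/=; rewrite in_itv/= !mulr1 => /andP[xt _]; apply: uc; exact: lt_le_trans xt.
Qed.

Definition upper_average th u : \bar R :=
  limf_esup (fun x => (average th u x)%:E) +oo%R.

Lemma upper_average_le th u c X : (forall x, X < x -> average th u x <= c) ->
  (upper_average th u <= c%:E)%E.
Proof.
move=> uc; apply: ge_ereal_inf; exists (ereal_sup ((fun x => (average th u x)%:E) @` [set x | X < x])).
  by exists [set x | X < x] => //; exists X; split => //; exact: num_real.
by apply: ge_ereal_sup => _ [x Xx <-]; rewrite lee_fin uc.
Qed.

Lemma upper_average_lt th u c : (upper_average th u < c%:E)%E ->
  exists X, forall x, X < x -> average th u x <= c.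
Proof.
move=> /ereal_inf_lt[_ [V [X [_ XV]] <-]] Vc; exists X => x Xx.
rewrite -lee_fin (le_trans _ (ltW Vc))//.
by apply: ereal_sup_ubound; exists x => //; exact: XV.
Qed.

(* Averaging [u] over a long window does not see whether [u] was first averaged
   over a short one, so the upper averages decrease to their infimum. *)
Lemma upper_average_cvg M u : bounded_by M u ->
  exists L : R, [/\ upper_average th u @[th --> +oo] --> L%:E,
    forall th c X, 0 < th -> (forall x, X < x -> average th u x <= c) -> L <= c &
    forall e, 0 < e -> exists th X, 0 < th /\ forall x, X < x -> average th u x <= L + e].
Proof.
move=> uM.
(* All eventual bounds of averages, over all window lengths; their infimum is the limit. *)
pose S := [set c | exists th X, 0 < th /\ forall x, X < x -> average th u x <= c].
have Slb : lbound S (- M).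
  move=> c [th [X [th0 /(_ (X + 1))]]]; rewrite ltrDl ltr01 => /(_ isT).
  apply: le_trans; have [_ /(_ (X + 1))] := bounded_average th0 uM.
  by rewrite ler_norml => /andP[].
have SM : S M.
  exists 1, 0; split=> // x _; have [_ /(_ x)] := bounded_average ltr01 uM.
  by rewrite ler_norml => /andP[].
have hS : has_inf S by split; [exists M|exists (- M)].
have Lle th c X : 0 < th -> (forall x, X < x -> average th u x <= c) -> inf S <= c.
  by move=> th0 uc; apply: ge_inf; [exists (- M)|exists th, X].
have Lad e : 0 < e -> exists th X, 0 < th /\ forall x, X < x -> average th u x <= inf S + e.
  move=> e0; have [c [th [X [th0 uc]]] cS] := inf_adherent e0 hS.
  by exists th, X; split=> // x /uc /le_trans; apply; exact: ltW.
exists (inf S); split=> //.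
have lower th : 0 < th -> ((inf S)%:E <= upper_average th u)%E.
  move=> th0; apply/lee_addgt0Pr => e e0; rewrite leNgt; apply/negP.
  rewrite -lteBrDr// -EFinB => /upper_average_lt[X /(Lle _ _ _ th0)]; lra.
have upper e : 0 < e -> \forall th \near +oo, (upper_average th u <= (inf S + e)%:E)%E.
  move=> e0; have e20 : 0 < e / 2 by rewrite divr_gt0.
  have [th0 [X [th00 uX]]] := Lad _ e20.
  have M0 := bounded_by_ge0 uM.
  (* Dividing by [M + 1] instead of [M] covers the case [M = 0]. *)
  have M1 : 0 < M + 1 by rewrite ltr_wpDl.
  have e3 : 0 < e / 2 / (M + 1) by rewrite divr_gt0.
  have /cvgrPdist_lt/(_ _ e3) H := average_error_cvg0 (L1_box th0).
  near=> th.
  have th_gt0 : 0 < th by near: th; exact: nbhs_pinfty_gt.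
  have : `|0 - average_error (box th0) th| < e / 2 / (M + 1) by near: th; exact: H.
  rewrite sub0r normrN => /(le_lt_trans (ler_norm _)); rewrite ltr_pdivlMr// => Hth.
  apply: (@upper_average_le _ _ _ X) => x Xx.
  have := average_conv_le x th_gt0 (L1_box th0) (Rintegral_box th00) uM.
  rewrite (conv_box _ uM) distrC => /(le_trans (ler_norm _)).
  have := average_le th_gt0 (bounded_average th00 uM) uX Xx.
  have : M * average_error (box th0) th <= average_error (box th0) th * (M + 1).
    by rewrite mulrC ler_wpM2l ?lerDl// Rintegral_ge0// => t _; rewrite mulr_ge0 ?modulus_ge0.
  lra.
apply/fine_cvgP; split.
  near=> th.
  have th_gt0 : 0 < th by near: th; exact: nbhs_pinfty_gt.
  rewrite fin_numE; apply/andP; split.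
    by have := lower _ th_gt0; case: (upper_average _ _).
  have : (upper_average th u <= (inf S + 1)%:E)%E by near: th; exact: upper.
  by case: (upper_average _ _).
apply/cvgrPdist_le => e e0; near=> th.
have th_gt0 : 0 < th by near: th; exact: nbhs_pinfty_gt.
have : (upper_average th u <= (inf S + e)%:E)%E by near: th; exact: upper.
have := lower _ th_gt0; rewrite /=; case: (upper_average _ _) => [r| |] //=.
rewrite !lee_fin => r1 r2; rewrite distrC ger0_norm ?subr_ge0//; lra.
Unshelve. all: end_near. Qed.

End running_average.

(** * Bounded functions as elements of Linfty *)

Section Linfty_transfer.
Context {R : realType}.
Local Notation mu := (@lebesgue_measure R).
Implicit Types (v w : R -> R) (u : Linfty R).

Lemma ae_mono (P Q : R -> Prop) : (forall x, P x -> Q x) ->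
  {ae mu, forall x, P x} -> {ae mu, forall x, Q x}.
Proof. by move=> PQ; exact: (@filterS _ _ (ae_filter_ringOfSetsType mu)). Qed.

Lemma lebesgue_measureT_gt0 : (0 < mu [set: R])%E.
Proof. by rewrite -set_itvNyy lebesgue_measure_itv/= addye// ltey. Qed.

Lemma Linfty_normE u : (`|u|%:E = ess_sup mu (abse \o (EFin \o u)))%E.
Proof.
have : ('N[mu]_+oo[EFin \o Lspace_rep u] < +oo)%E by exact: Lfunction_finite.
rewrite -[`|u|]/(fine ('N[mu]_+oo[EFin \o Lspace_rep u])) unlock lebesgue_measureT_gt0 => uoo.
rewrite fineK// ge0_fin_numE//.
by apply: ess_sup_gee; [exact: lebesgue_measureT_gt0|apply: aeW => x; exact: abse_ge0].
Qed.

Lemma Linfty_ae_norm u : {ae mu, forall x, `|u x| <= `|u|}.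
Proof.
have := ess_sup_ge mu (abse \o (EFin \o u)); rewrite -Linfty_normE.
by apply: ae_mono => x /=; rewrite lee_fin.
Qed.

Lemma Linfty_norm_le u (M : R) : {ae mu, forall x, `|u x| <= M} -> `|u| <= M.
Proof.
move=> uM; rewrite -lee_fin Linfty_normE; apply/ess_supP.
by apply: ae_mono uM => x; rewrite /= lee_fin.
Qed.

Lemma Linfty_eq (u1 u2 : Linfty R) : {ae mu, forall x, u1 x = u2 x} -> u1 = u2.
Proof.
move=> u12; rewrite -[LHS]Lspace_repK -[RHS]Lspace_repK; apply/Lspace_classP.
by apply: ae_mono u12 => x e _.
Qed.

Lemma measurable_Linfty u : measurable_fun setT (u : R -> R).
Proof. exact: (@measurable_funPT _ _ _ _ (Lspace_rep u)). Qed.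

Lemma bounded_Lfun M v : bounded_by M v -> v \in Lfun mu +oo%E.
Proof.
move=> [mv vM]; apply/andP; split; apply/mem_set => //=.
rewrite /finite_norm unlock lebesgue_measureT_gt0.
apply: (@le_lt_trans _ _ M%:E); last exact: ltry.
by apply/ess_supP/aeW => x /=; rewrite lee_fin.
Qed.

(** Total, with default 0, so that composing with it yields a functional on all functions, as
    [conv_invariant] expects. Functions satisfying [bounded_by] never meet the default. *)
Definition Linfty_of v : Linfty R :=
  if pselect (v \in Lfun mu +oo%E) is left h
  then Lspace_class (Lfun_Sub (leey 1%E) h) else 0.

Lemma Linfty_ofP M v : bounded_by M v -> {ae mu, forall x, Linfty_of v x = v x}.
Proof.
move=> vM; rewrite /Linfty_of; case: pselect => [h|]; last by rewrite (bounded_Lfun vM).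
have := Lspace_classK (Lfun_Sub (leey 1%E) h).
by apply: ae_mono => x /(_ I).
Qed.

Lemma Linfty_of_norm M v : bounded_by M v -> `|Linfty_of v| <= M.
Proof.
move=> vM; apply: Linfty_norm_le; apply: ae_mono (Linfty_ofP vM) => x ->.
by case: vM.
Qed.

Lemma Linfty_addE (u1 u2 : Linfty R) : {ae mu, forall x, (u1 + u2 : Linfty R) x = u1 x + u2 x}.
Proof.
have := Lspace_classK (Lspace_rep u1 + Lspace_rep u2).
by apply: ae_mono => x /(_ I).
Qed.

Lemma Linfty_scaleE (c : R) u : {ae mu, forall x, (c *: u : Linfty R) x = c * u x}.
Proof.
have := Lspace_classK (c *: Lspace_rep u).
by apply: ae_mono => x /(_ I).
Qed.

Lemma ae_and (P Q : R -> Prop) : {ae mu, forall x, P x} -> {ae mu, forall x, Q x} ->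
  {ae mu, forall x, P x /\ Q x}.
Proof. exact: (@filterI _ _ (ae_filter_ringOfSetsType mu)). Qed.

Lemma Linfty_of_ae M v u : bounded_by M v -> {ae mu, forall x, u x = v x} -> Linfty_of v = u.
Proof.
move=> vM uv; apply: Linfty_eq.
by apply: ae_mono (ae_and (Linfty_ofP vM) uv) => x [-> ->].
Qed.

Lemma Linfty_ofD M N v w : bounded_by M v -> bounded_by N w ->
  Linfty_of (fun x => v x + w x) = Linfty_of v + Linfty_of w.
Proof.
move=> vM wN; apply: (Linfty_of_ae (bounded_byD vM wN)).
have := ae_and (Linfty_addE (Linfty_of v) (Linfty_of w)) (ae_and (Linfty_ofP vM) (Linfty_ofP wN)).
by apply: ae_mono => x [-> [-> ->]].
Qed.

Lemma Linfty_ofZ c M v : bounded_by M v -> Linfty_of (fun x => c * v x) = c *: Linfty_of v.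
Proof.
move=> vM; apply: (Linfty_of_ae (bounded_byZ c vM)).
have := ae_and (Linfty_scaleE c (Linfty_of v)) (Linfty_ofP vM).
by apply: ae_mono => x [-> ->].
Qed.

Lemma L1_integrable (f : L1 R) : L1fun (f : R -> R).
Proof. exact/Lfun1_integrable/(LfunP (Lspace_rep f)). Qed.

Lemma Linfty_of_conv (f : L1 R) M v : bounded_by M v ->
  conv_op f (Linfty_of v) = Linfty_of (convolution (f : R -> R) v).
Proof.
move=> vM; have h := bounded_Lfun vM.
have -> : Linfty_of v = Lspace_class (Lfun_Sub (leey 1%E) h).
  rewrite /Linfty_of; case: pselect => // h'.
  by rewrite (bool_irrelevance h h').
rewrite conv_op_class; apply/esym.
have ifL := L1_integrable f.
apply: (Linfty_of_ae (conv_bounded ifL vM)).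
by have := Lspace_classK (conv_Lfun f (Lfun_Sub (leey 1%E) h)); apply: ae_mono => x /(_ I).
Qed.

Definition clamp (e y : R) : R := Num.max (- e) (Num.min e y).

Lemma clamp_id e y : `|y| <= e -> clamp e y = y.
Proof.
rewrite ler_norml => /andP[ey ye]; rewrite /clamp (min_idPr ye).
exact/max_idPr.
Qed.

Lemma bounded_clamp e v : 0 <= e -> measurable_fun setT v ->
  bounded_by e (fun x => clamp e (v x)).
Proof.
move=> e0 mv; split.
  by apply: measurable_maxr => //; exact: measurable_minr.
move=> x; rewrite ler_norml /clamp le_max lexx/= ge_max ge_min lexx/= andbT.
by rewrite (le_trans _ e0)// oppr_le0.
Qed.

(** A representative bounded everywhere: clamping at the norm changes [u] only on a null set. *)
Definition truncation u : R -> R := fun x => clamp `|u| (u x).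

Lemma bounded_truncation u : bounded_by `|u| (truncation u).
Proof. by apply: bounded_clamp => //; exact: measurable_Linfty. Qed.

Lemma truncation_ae u : {ae mu, forall x, u x = truncation u x}.
Proof. by apply: ae_mono (Linfty_ae_norm u) => x ux; rewrite /truncation clamp_id. Qed.

Lemma Linfty_of_truncation u : Linfty_of (truncation u) = u.
Proof. exact: (Linfty_of_ae (bounded_truncation u) (truncation_ae u)). Qed.

Lemma average_ae th x v w : measurable_fun setT v -> measurable_fun setT w ->
  {ae mu, forall t, v t = w t} -> average th v x = average th w x.
Proof.
move=> mv mw vw; congr (_ * _); rewrite !Rintegral_itv_indic.
have mI : measurable_fun setT (\1_(`[x, x + th]) : R -> R) by exact: measurable_indic.
apply: Rintegral_ae_eq; [exact: measurable_funM|exact: measurable_funM|].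
by apply: ae_mono vw => t ->.
Qed.

(** This replaces limits by inequalities: an eventual bound for a single window length already
    bounds [L], and some window has averages eventually below [L + e]. *)
Lemma Pbar_Linfty_of M v : bounded_by M v ->
  exists L : R, [/\ Pbar (Linfty_of v) = L%:E,
    forall th c X, 0 < th -> (forall x, X < x -> average th v x <= c) -> L <= c &
    forall e, 0 < e -> exists th X, 0 < th /\ forall x, X < x -> average th v x <= L + e].
Proof.
move=> vM; have [L [cL L1 L2]] := upper_average_cvg vM.
exists L; split => //; rewrite /Pbar.
have -> : (fun theta : R => limf_esup
    (fun x : R => (theta^-1 * \int[mu]_(t in `[x, x + theta]) Linfty_of v t)%:E) +oo%R) =
    (fun th => upper_average th v).
  apply/funext => th; rewrite /upper_average.
  rewrite -(_ : (fun x => (average th (Linfty_of v) x)%:E) = (fun x => (average th v x)%:E))//.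
  apply/funext => x; apply: (congr1 EFin).
  by apply: average_ae; [exact: measurable_Linfty|case: vM|exact: Linfty_ofP vM].
exact: cvg_lim cL.
Qed.

End Linfty_transfer.

(** * Invariant means *)

Section mean_theorem.
Context {R : realType}.
Local Notation mu := (@lebesgue_measure R).
Implicit Types (v w : R -> R) (u : Linfty R).

Lemma fourierE (f : L1 R) (xi : R) :
  fourier f xi = (cosine_transform (f : R -> R) xi +i* (- sine_transform (f : R -> R) xi))%C.
Proof.
have ifL := L1_integrable f.
rewrite /fourier /Cintegral; congr (_ +i* _)%C.
  by apply: eq_Rintegral => x _; rewrite /= mul0r subr0 cosN.
rewrite -mulN1r -RintegralZl//; last exact: L1M_sin.
by apply: eq_Rintegral => x _; rewrite /= mul0r addr0 sinN mulrN mulN1r.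
Qed.

Lemma L1_star_gap (f : L1 R) : L1_star f ->
  forall xi, xi != 0 -> 0 < spectral_gap (f : R -> R) xi.
Proof.
move=> hf xi xi0; rewrite lt_neqAle addr_ge0 ?sqr_ge0// andbT eq_sym.
rewrite paddr_eq0 ?sqr_ge0// !sqrf_eq0; apply: contra xi0 => /andP[/eqP c /eqP s].
apply/eqP/hf; rewrite fourierE s oppr0.
have -> // : cosine_transform (f : R -> R) xi = 1.
by move/eqP: c; rewrite subr_eq0 => /eqP.
Qed.

Lemma L1_star_integral (f : L1 R) : L1_star f -> \int[mu]_x f x = 1.
Proof.
move=> hf; have /hf := erefl (0 : R); rewrite fourierE => /(congr1 (@complex.Re R)) /= f0.
by apply: etrans f0; apply: eq_Rintegral => x _; rewrite mul0r cos0 mulr1.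
Qed.

Definition on_functions (phi : {linear Linfty R -> R^o}) v : R := phi (Linfty_of v).

Lemma on_functionsD (phi : {linear Linfty R -> R^o}) M N v w :
  bounded_by M v -> bounded_by N w ->
  on_functions phi (fun x => v x + w x) = on_functions phi v + on_functions phi w.
Proof. by move=> vM wN; rewrite /on_functions (Linfty_ofD vM wN) linearD. Qed.

Lemma on_functionsZ (phi : {linear Linfty R -> R^o}) c M v : bounded_by M v ->
  on_functions phi (fun x => c * v x) = c * on_functions phi v.
Proof. by move=> vM; rewrite /on_functions (Linfty_ofZ c vM) linearZ. Qed.

Lemma on_functionsB (phi : {linear Linfty R -> R^o}) M N v w :
  bounded_by M v -> bounded_by N w ->
  on_functions phi (fun x => v x - w x) = on_functions phi v - on_functions phi w.
Proof.
move=> vM wN; rewrite -[in RHS]mulN1r -(on_functionsZ phi _ wN).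
rewrite -(on_functionsD phi vM (bounded_byZ (-1) wN)).
by congr on_functions; apply/funext => x; rewrite mulN1r.
Qed.

Lemma bounded_by1 : bounded_by 1 (cst (1 : R)).
Proof. by split => // x; rewrite normr1. Qed.

Lemma on_functions_ge0 (phi : {linear Linfty R -> R^o}) M v : mean phi -> bounded_by M v ->
  (forall x, 0 <= v x) -> 0 <= on_functions phi v.
Proof.
move=> [_ pos _] vM v0; apply: pos.
by apply: ae_mono (Linfty_ofP vM) => x ->.
Qed.

(** The factor [on_functions phi (cst 1)] remains because [mean_one] is itself derived from this
    bound. *)
Lemma on_functions_le (phi : {linear Linfty R -> R^o}) M v (c : R) : mean phi ->
  bounded_by M v -> (forall x, v x <= c) ->
  on_functions phi v <= c * on_functions phi (cst 1).
Proof.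
move=> mphi vM vc; rewrite -subr_ge0 -(on_functionsZ phi c bounded_by1).
have cM := bounded_byZ c bounded_by1.
rewrite -(on_functionsB phi cM vM); apply: (on_functions_ge0 mphi (bounded_byB cM vM)).
by move=> x; rewrite mulr1 subr_ge0.
Qed.

(** For a positive functional the norm is attained at the constant 1: [|u| <= 1] bounds both [phi u]
    and its negative by the value at 1. *)
Lemma mean_one (phi : {linear Linfty R -> R^o}) : mean phi -> on_functions phi (cst 1) = 1.
Proof.
move=> mphi; have [_ _ norm1] := mphi.
have ub : ubound [set `|phi u| | u in [set u : Linfty R | `|u| <= 1]] (on_functions phi (cst 1)).
  move=> _ [u /= u1 <-]; rewrite -(Linfty_of_truncation u).
  have uM := bounded_truncation u.
  have tle x : `|truncation u x| <= 1 by case: uM => _ /(_ x) /le_trans; apply.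
  have NuM := bounded_byZ (-1) uM.
  rewrite ler_norml; apply/andP; split.
    rewrite lerNl -mulN1r -(on_functionsZ phi (-1) uM) -[leRHS]mul1r.
    apply: (on_functions_le mphi NuM) => x; rewrite mulN1r.
    by have := tle x; rewrite ler_norml lerNl => /andP[].
  rewrite -[leRHS]mul1r; apply: (on_functions_le mphi uM) => x.
  by rewrite (le_trans (ler_norm _)).
have one_in : [set `|phi u| | u in [set u : Linfty R | `|u| <= 1]] `|on_functions phi (cst 1)|.
  by exists (Linfty_of (cst 1)) => //=; exact: (Linfty_of_norm bounded_by1).
apply/eqP; rewrite eq_le; apply/andP; split.
  rewrite (le_trans (ler_norm _))// -[leRHS]norm1 /dual_norm.
  by apply: ub_le_sup one_in; exists (on_functions phi (cst 1)).
by rewrite -[leLHS]norm1 /dual_norm; apply: ge_sup => //; eexists; exact: one_in.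
Qed.

Lemma mean_conv_invariant (f : L1 R) (phi : {linear Linfty R -> R^o}) : mean phi ->
  conv_adjoint f phi = phi -> conv_invariant (f : R -> R) (on_functions phi).
Proof.
move=> mphi inv; have phi1 := mean_one mphi; split.
- by move=> M N v w; exact: on_functionsD.
- by move=> c M v; exact: on_functionsZ.
- move=> M v vM; have vle x : `|v x| <= M by case: vM.
  rewrite ler_norml; apply/andP; split.
    rewrite lerNl -mulN1r -(on_functionsZ phi (-1) vM) -[leRHS]mulr1 -[X in _ <= M * X]phi1.
    apply: (on_functions_le mphi (bounded_byZ (-1) vM)) => x; rewrite mulN1r.
    by have := vle x; rewrite ler_norml lerNl => /andP[].
  rewrite -[leRHS]mulr1 -[X in _ <= M * X]phi1; apply: (on_functions_le mphi vM) => x.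
  by rewrite (le_trans (ler_norm _)).
- move=> M v vM; rewrite /on_functions -(Linfty_of_conv f vM).
  exact: (congr1 (@^~ (Linfty_of v)) inv).
Qed.

(** * Invariant means lie below the upper averages *)

Lemma invariant_mean_average (f : L1 R) (phi : {linear Linfty R -> R^o}) M v (th : R) :
  L1_star f -> invariant_mean f phi -> bounded_by M v -> 0 < th ->
  on_functions phi (average th v) = on_functions phi v.
Proof.
move=> hf [mphi inv _] vM th0.
have ifL := L1_integrable f.
have phiP := mean_conv_invariant mphi inv.
have iB := @L1_box R th.
have h0 : \int[mu]_x (f x - box th x) = 0.
  by rewrite RintegralB// Rintegral_box// L1_star_integral// subrr.
have := phi_conv_mean0 ifL phiP (L1_star_gap hf) (L1B ifL iB) h0 vM.
rewrite (convBl ifL iB vM) (conv_box th vM).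
rewrite (on_functionsB phi (conv_bounded ifL vM) (bounded_average th0 vM)).
case: phiP => _ _ _ phi_inv; rewrite (phi_inv _ _ vM).
by move/eqP; rewrite subr_eq0 => /eqP ->.
Qed.

Lemma invariant_mean_le_eventually (f : L1 R) (phi : {linear Linfty R -> R^o}) M v (c X : R) :
  invariant_mean f phi -> bounded_by M v -> (forall x, X < x -> v x <= c) ->
  on_functions phi v <= c.
Proof.
move=> [mphi _ van] vM vc.
(* Subtracting [w] replaces [v] by [c] up to [X]; this leaves [phi v] unchanged, as [w] vanishes
   beyond [X]. *)
pose w x : R := (v x - c) * \1_(`]-oo, X]) x.
have cM := @bounded_by_cst R c.
have IM : bounded_by 1 (\1_(`]-oo, X]) : R -> R).
  split; first exact: measurable_indic.
  by move=> x; rewrite indicE; case: (_ \in _); rewrite ?normr1 ?normr0.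
have wM : bounded_by ((M + `|c|) * 1) w by exact: (bounded_byM (bounded_byB vM cM) IM).
have w0 : on_functions phi w = 0.
  apply: van => e e0; exists X; apply: ae_mono (Linfty_ofP wM) => x -> Xx.
  by rewrite /w indicE memNset/= ?mulr0 ?normr0// in_itv/= => /(lt_le_trans Xx); rewrite ltxx.
rewrite -[leLHS]subr0 -w0 -(on_functionsB phi vM wM) -[leRHS]mulr1 -[X in _ <= c * X](mean_one mphi).
apply: (on_functions_le mphi (bounded_byB vM wM)) => x; rewrite /w indicE.
have [xX|Xx] := leP x X.
  by rewrite mem_set/= ?in_itv//= mulr1; lra.
by rewrite memNset/= ?in_itv/= ?mulr0 ?subr0 ?vc// leNgt Xx.
Qed.

Lemma invariant_mean_le_Pbar (f : L1 R) (phi : {linear Linfty R -> R^o}) u :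
  L1_star f -> invariant_mean f phi -> ((phi u)%:E <= Pbar u)%E.
Proof.
move=> hf mphi; have uM := bounded_truncation u.
have [L [PL _ Lle]] := Pbar_Linfty_of uM.
rewrite Linfty_of_truncation in PL; rewrite PL lee_fin.
apply/ler_addgt0Pr => e e0; have [th [X [th0 uX]]] := Lle _ e0.
rewrite -(Linfty_of_truncation u) -[leLHS]/(on_functions phi (truncation u)).
rewrite -(invariant_mean_average hf mphi uM th0).
exact: (invariant_mean_le_eventually mphi (bounded_average th0 uM) uX).
Qed.

(** * Functionals below the upper averages are invariant means *)

Lemma le_of_average_le (phi : {linear Linfty R -> R^o}) M v (th c X : R) :
  (forall u, (phi u)%:E <= Pbar u)%E -> bounded_by M v -> 0 < th ->
  (forall x, X < x -> average th v x <= c) -> on_functions phi v <= c.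
Proof.
move=> phiP vM th0 vc; have [L [PL Lle _]] := Pbar_Linfty_of vM.
have := phiP (Linfty_of v); rewrite PL lee_fin => /le_trans; apply.
exact: Lle vc.
Qed.

Lemma le_of_le_eventually (phi : {linear Linfty R -> R^o}) M v (c X : R) :
  (forall u, (phi u)%:E <= Pbar u)%E -> bounded_by M v ->
  (forall x, X < x -> v x <= c) -> on_functions phi v <= c.
Proof.
move=> phiP vM vc; apply: (le_of_average_le phiP vM ltr01).
exact: (average_le ltr01 vM vc).
Qed.

Lemma norm_le_of_norm_le_eventually (phi : {linear Linfty R -> R^o}) M v (c X : R) :
  (forall u, (phi u)%:E <= Pbar u)%E -> bounded_by M v ->
  (forall x, X < x -> `|v x| <= c) -> `|on_functions phi v| <= c.
Proof.
move=> phiP vM vc; rewrite ler_norml; apply/andP; split.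
  rewrite lerNl -mulN1r -(on_functionsZ phi (-1) vM).
  apply: (le_of_le_eventually phiP (bounded_byZ (-1) vM)) => x /vc.
  by rewrite mulN1r ler_norml lerNl => /andP[].
by apply: (le_of_le_eventually phiP vM) => x /vc; exact/le_trans/ler_norm.
Qed.

(** Applying the upper bound to the negative of a function gives lower bounds, hence positivity and
    a value at least 1 at the constant 1. *)
Lemma mean_of_le_Pbar (phi : {linear Linfty R -> R^o}) : continuous phi ->
  (forall u, (phi u)%:E <= Pbar u)%E -> mean phi.
Proof.
move=> cphi phiP; split => //.
- move=> u u0; have [mt tM] := bounded_truncation u.
  have aM : bounded_by `|u| (fun x => `|truncation u x|).
    by split; [exact: measurableT_comp|move=> x; rewrite normr_id].
  (* This representative of [u] is nonnegative everywhere, not only almost everywhere. *)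
  have <- : Linfty_of (fun x => `|truncation u x|) = u.
    apply: (Linfty_of_ae aM).
    by apply: ae_mono (ae_and (truncation_ae u) u0) => x [<- ?]; rewrite ger0_norm.
  rewrite -oppr_le0 -mulN1r -[phi _]/(on_functions phi _) -(on_functionsZ phi (-1) aM).
  apply: (@le_of_le_eventually phi _ _ 0 0 phiP (bounded_byZ (-1) aM)) => x _.
  by rewrite mulN1r oppr_le0.
have one1 : 1 <= on_functions phi (cst 1).
  rewrite -lerN2 -[leLHS]mulN1r -(on_functionsZ phi (-1) bounded_by1).
  apply: (@le_of_le_eventually phi _ _ (-1) 0 phiP (bounded_byZ (-1) bounded_by1)) => x _.
  by rewrite mulr1.
have ub : ubound [set `|phi u| | u in [set u : Linfty R | `|u| <= 1]] 1.
  move=> _ [u /= u1 <-]; rewrite -(Linfty_of_truncation u).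
  have uM := bounded_truncation u.
  apply: (@norm_le_of_norm_le_eventually phi _ _ 1 0 phiP uM) => x _.
  by case: uM => _ /(_ x) /le_trans; apply.
have one_in : [set `|phi u| | u in [set u : Linfty R | `|u| <= 1]] `|on_functions phi (cst 1)|.
  by exists (Linfty_of (cst 1)) => //=; exact: (Linfty_of_norm bounded_by1).
apply/eqP; rewrite eq_le /dual_norm; apply/andP; split.
  by apply: ge_sup => //; eexists; exact: one_in.
rewrite (le_trans one1)// (le_trans (ler_norm _))//.
by apply: ub_le_sup one_in; exists 1.
Qed.

(** By [average_conv_le], the averages of the difference between [v] and its convolution with [f]
    are uniformly small over a long window. The same holds for its negative, so [phi] of the
    difference is squeezed to 0. *)
Lemma conv_adjoint_of_le_Pbar (f : L1 R) (phi : {linear Linfty R -> R^o}) : L1_star f ->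
  (forall u, (phi u)%:E <= Pbar u)%E -> conv_adjoint f phi = phi.
Proof.
move=> hf phiP; apply/funext => u; rewrite /conv_adjoint /= -(Linfty_of_truncation u).
have uM := bounded_truncation u; have M0 := bounded_by_ge0 uM.
have ifL := L1_integrable f.
have f1 := L1_star_integral hf.
rewrite (Linfty_of_conv f uM); apply/eqP; rewrite -subr_eq0 -normr_le0.
set v := truncation u in uM *; have cM := conv_bounded ifL uM.
have dM := bounded_byB cM uM.
rewrite -[X in `|X|]/(on_functions phi _ - on_functions phi _) -(on_functionsB phi cM uM).
apply/ler_addgt0Pr => e e0; rewrite add0r.
have M1 : 0 < `|u| + 1 by rewrite ltr_wpDl.
have e1 : 0 < e / (`|u| + 1) by rewrite divr_gt0.
have [th th0 small] : exists2 th, 0 < th & `|u| * average_error (f : R -> R) th <= e.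
  have /cvgrPdist_lt/(_ _ e1) [X [_ HX]] := average_error_cvg0 ifL.
  (* This window length is both positive and beyond [X]. *)
  exists (`|X| + 1); first by rewrite ltr_wpDl.
  have := HX (`|X| + 1); rewrite (le_lt_trans (ler_norm X)) ?ltrDl// => /(_ isT).
  rewrite sub0r normrN => /(le_lt_trans (ler_norm _)); rewrite ltr_pdivlMr// => /ltW.
  apply: le_trans; rewrite mulrC ler_wpM2l ?lerDl//.
  by rewrite Rintegral_ge0// => t _; rewrite mulr_ge0 ?modulus_ge0.
have avB x : average th (fun x => convolution (f : R -> R) v x - v x) x =
    average th (convolution (f : R -> R) v) x - average th v x.
  rewrite -(conv_box th dM) (convB (L1_box th) cM uM).
  by rewrite (conv_box th cM) (conv_box th uM).
have av_le x : `|average th (fun x => convolution (f : R -> R) v x - v x) x| <= e.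
  by rewrite avB (le_trans (average_conv_le x th0 ifL f1 uM)).
rewrite ler_norml; apply/andP; split.
  rewrite lerNl -mulN1r -(on_functionsZ phi (-1) dM).
  apply: (@le_of_average_le phi _ _ th _ 0 phiP (bounded_byZ (-1) dM) th0) => x _.
  rewrite -(conv_box th (bounded_byZ (-1) dM)) (convZ (-1) (L1_box th) dM) (conv_box th dM).
  by rewrite mulN1r; have := av_le x; rewrite ler_norml lerNl => /andP[].
apply: (@le_of_average_le phi _ _ th _ 0 phiP dM th0) => x _.
by rewrite (le_trans (ler_norm _)).
Qed.

(** The bounds at hand ask for a function that is small everywhere beyond [A]. Keeping the
    truncation up to [A] and clamping it at [e] afterwards gives such a representative of [u]. *)
Lemma ess_cvg0_of_le_Pbar (phi : {linear Linfty R -> R^o}) u :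
  (forall u, (phi u)%:E <= Pbar u)%E -> ess_cvg0 u -> phi u = 0.
Proof.
move=> phiP u0; apply/eqP; rewrite -normr_le0; apply/ler_addgt0Pr => e e0; rewrite add0r.
have [A Ae] := u0 _ e0; have uM := bounded_truncation u.
have [mt _] := uM.
pose I x : R := \1_(`]-oo, A]) x.
have mI : measurable_fun setT I by exact: measurable_indic.
have I01 x : I x = (x <= A)%R%:R.
  rewrite /I indicE; congr (nat_of_bool _)%:R.
  by apply/idP/idP => [/set_mem/=|xA]; [rewrite in_itv|apply/mem_set; rewrite /= in_itv].
have IM : bounded_by 1 I.
  by split => // x; rewrite I01; case: (x <= A); rewrite ?normr1 ?normr0.
have cM := bounded_clamp (ltW e0) mt.
have vM := bounded_byD (bounded_byM IM uM)
  (bounded_byM (bounded_byB bounded_by1 IM) cM).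
rewrite -(Linfty_of_ae vM (u := u)).
  apply: (@norm_le_of_norm_le_eventually phi _ _ e A phiP vM) => x Ax.
  rewrite I01 [x <= A]leNgt Ax/= mul0r add0r subr0 mul1r.
  by case: cM.
apply: ae_mono (ae_and Ae (truncation_ae u)) => x [xe ux].
rewrite I01 -ux; have [xA|Ax] := leP x A; first by rewrite subrr mul0r addr0 mul1r.
by rewrite mul0r add0r subr0 mul1r clamp_id// ltW// xe.
Qed.

End mean_theorem.

Theorem theorem3p7 (R : realType) (f : L1 R) (hf : L1_star f)
    (phi : {linear Linfty R -> R^o}) (cphi : continuous phi) :
  invariant_mean f phi <-> forall u : Linfty R, ((phi u)%:E <= Pbar u)%E.
Proof.
split=> [mphi u|phiP]; first exact: invariant_mean_le_Pbar mphi.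
split.
- exact: mean_of_le_Pbar.
- exact: conv_adjoint_of_le_Pbar.
- by move=> u; exact: ess_cvg0_of_le_Pbar.
Qed.
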